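(* Let $s>1$ and $c\in\mathbb R$. (1) $\bigl(\overline{\mathbb R},\,F_s'/F_s{\restriction}(c,\infty)\bigr)$ defines $\mathbb Z$. (2) $\bigl(\overline{\mathbb R},\,(xF_s'/F_s)'{\restriction}(c,\infty)\bigr)$ defines $s^{\mathbb Z}=\{s^k:k\in\mathbb Z\}$. (3) If $r>0$ and $r\notin\mathbb Q$, then $\bigl(\overline{\mathbb R},\,(xF_s'/F_s)'{\restriction}(c,\infty),\,(xF_{s^r}'/F_{s^r})'{\restriction}(c,\infty)\bigr)$ defines $\mathbb Z$. (4) $(\mathbb R_{\mathrm{an}},s^{\mathbb Z})$ defines $(xF_{s^q}'/F_{s^q})'{\restriction}(c,\infty)$ for each rational $q>0$.
   Context: $\overline{\mathbb R}=(\mathbb R,+,\cdot,(r)_{r\in\mathbb R})$ is the real field with a constant for each real number. ''Defines'' means first-order definable (parameters from $\mathbb R$ allowed), functions being identified with their graphs; expansions are obtained by adding the listed functions or sets as primitives. $\mathbb R_{\mathrm{an}}$ is the expansion of $\overline{\mathbb R}$ by all restrictions to $[0,1]^m$, $m\geq 1$, of real-analytic functions on neighbourhoods of $[0,1]^m$ (extended by $0$ outside). For a real number $a>1$, $F_a(z)=\prod_{n>0}(1+a^{-n}z)$, an entire function, real on the real line, with zero set $\{-a^n:n>0\}$. $F_a'/F_a$ and $(xF_a'/F_a)'$ (the derivative of $x\mapsto xF_a'(x)/F_a(x)$) are regarded as real functions defined off the zeros of $F_a$; restriction to $(c,\infty)$ means restriction to the points of $(c,\infty)$ at which $F_a\ne0$.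 *)

(* Defs.v *)
From HB Require Import structures.
From mathcomp Require Import all_boot all_order all_algebra.
From mathcomp Require Import all_classical all_reals all_analysis.

Set Implicit Arguments.
Unset Strict Implicit.
Unset Printing Implicit Defensive.

Import Order.TTheory GRing.Theory Num.Theory.
Import numFieldNormedType.Exports.

Local Open Scope classical_set_scope.
Local Open Scope ring_scope.

(* First-order definability in expansions of the real field with a constant
   for every real number.  An expansion is given by the set of its additional
   primitives, each one a subset of some R^n; a function is a primitive via
   its graph. *)

Definition primitive (R : realType) := {n : nat & set 'rV[R]_n}.

Definition prim (R : realType) (n : nat) (A : set 'rV[R]_n) : primitive R :=
  existT (fun n => set 'rV[R]_n) n A.

Inductive term (R : realType) : Type :=
| Var of nat
| Const of R
| Add of term R & term R
| Mul of term R & term R.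

Fixpoint eval (R : realType) (e : nat -> R) (t : term R) : R :=
  match t with
  | Var i => e i
  | Const r => r
  | Add t1 t2 => eval e t1 + eval e t2
  | Mul t1 t2 => eval e t1 * eval e t2
  end.

(* Variables are de Bruijn indices: [Ex phi] binds variable 0 of [phi]. *)
Inductive formula (R : realType) (L : set (primitive R)) : Type :=
| Equal of term R & term R
| Atom (P : primitive R) of L P & ('I_(projT1 P) -> term R)
| Not of formula L
| And of formula L & formula L
| Ex of formula L.

Definition push (T : Type) (x : T) (e : nat -> T) : nat -> T :=
  fun i => if i is j.+1 then e j else x.

Fixpoint holds (R : realType) (L : set (primitive R)) (e : nat -> R)
    (phi : formula L) : Prop :=
  match phi with
  | Equal t1 t2 => eval e t1 = eval e t2
  | Atom P _ t => projT2 P (\row_i eval e (t i))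
  | Not phi1 => ~ holds e phi1
  | And phi1 phi2 => holds e phi1 /\ holds e phi2
  | Ex phi1 => exists x, holds (push x e) phi1
  end.

(* Free variables beyond the n coordinates are read as 0, which adds nothing
   since all real constants are available. *)
Definition env (R : realType) (n : nat) (x : 'rV[R]_n) : nat -> R :=
  fun i => if insub i is Some j then x 0 j else 0.

Definition defines (R : realType) (L : set (primitive R)) (n : nat)
    (A : set 'rV[R]_n) : Prop :=
  exists phi : formula L, forall x, A x <-> holds (env x) phi.

Definition graph_on (R : realType) (m : nat) (D : set 'rV[R]_m)
    (f : 'rV[R]_m -> R) : set 'rV[R]_(m + 1) :=
  [set row_mx x (const_mx (f x)) | x in D].

Definition line_set (R : realType) (A : set R) : set 'rV[R]_1 :=
  [set x | A (x 0 0)].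

Definition line_graph_on (R : realType) (D : set R) (f : R -> R) :
    set 'rV[R]_(1 + 1) :=
  graph_on (line_set D) (fun x => f (x 0 0)).

Definition unit_cube (R : realType) (m : nat) : set 'rV[R]_m :=
  [set x | forall i, 0 <= x 0 i <= 1].

(* Sum over the multi-indices in {0, ..., N - 1}^m. *)
Definition power_series_sum (R : realType) (m : nat)
    (c : ('I_m -> nat) -> R) (y : 'rV[R]_m) (N : nat) : R :=
  \sum_(k : {ffun 'I_m -> 'I_N})
    c (fun i => k i : nat) * \prod_(i < m) y 0 i ^+ k i.

(* A multiple power series is summed absolutely; the cubical partial sums then
   compute its value. *)
Definition real_analytic_at (R : realType) (m : nat) (f : 'rV[R]_m -> R)
    (a : 'rV[R]_m) : Prop :=
  exists (c : ('I_m -> nat) -> R) (d : R), 0 < d /\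
    forall x : 'rV[R]_m, (forall i, `|x 0 i - a 0 i| < d) ->
      cvgn (power_series_sum (fun k => `|c k|) (map_mx Num.norm (x - a))) /\
      power_series_sum c (x - a) @ \oo --> f x.

Definition R_an (R : realType) : set (primitive R) :=
  [set P | exists (m : nat) (U : set 'rV[R]_m) (f : 'rV[R]_m -> R),
    [/\ (0 < m)%N, open U, @unit_cube R m `<=` U,
        forall a, U a -> real_analytic_at f a &
        P = prim (graph_on setT (patch (fun=> 0) (@unit_cube R m) f))]].

(* The restriction to the real line of the entire function F_a. *)
Definition F (R : realType) (a x : R) : R :=
  limn (fun N : nat => \prod_(1 <= n < N) (1 + a ^- n * x)).

Definition logder_F (R : realType) (a x : R) : R := derive1 (F a) x / F a x.

Definition xlogder_F' (R : realType) (a : R) : R -> R :=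
  derive1 (fun x => x * logder_F a x).

Definition off_zeros (R : realType) (a c : R) : set R :=
  [set x | c < x /\ F a x != 0].

Definition int_set (R : realType) : set 'rV[R]_1 :=
  line_set [set k%:~R | k in [set: int]].

Definition int_powers (R : realType) (s : R) : set 'rV[R]_1 :=
  line_set [set s ^ k | k in [set: int]].

(* Main.v *)
From mathcomp Require Import all_boot all_order all_algebra.
From mathcomp Require Import all_classical all_reals all_analysis.
From mathcomp Require Import ring lra zify.
Require Import Defs.

Set Implicit Arguments.
Unset Strict Implicit.
Unset Printing Implicit Defensive.

Import Order.TTheory GRing.Theory Num.Theory.
Import numFieldNormedType.Exports.

Local Open Scope classical_set_scope.
Local Open Scope ring_scope.

(** Write [D] for the derivative of [x F_a'(x) / F_a(x)]; it is the sum over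
    [n > 0] of [a^n / (a^n + x)^2].  The functional equation
    [F_a (a x) = (1 + x) F_a x] gives [a x D (a x) = x D x + x / (1 + x)^2], so
    that [x D x] is asymptotic at infinity to
    [Theta x = sum_(n in Z) a^n x / (a^n + x)^2], which is invariant under
    [x |-> a x].
    (2) [a^Z] is the set of [t > 0] with [t x D (t x) - x D x -> 0].  Indeed such
    a [t] is a multiplicative period of [Theta], hence the sums of
    [tau / (tau + z)^2] over [tau] in [a^Z] and over [a^Z / t] agree for all
    [z > 0].  Differentiating in [z] at [1], so do the sums of
    [tau s^2 p(s)], [s = 1 / (1 + tau)], for all polynomials
    [p].  For [p = (4 s (1 - s))^N] the first sum stays [>= 1/4], while the
    second one tends to [0] unless [1] is in [a^Z / t].
    (1) [D] is definable from [F_a'/F_a]; then [Z] is the set of limits at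
    infinity of [G (t x) - G x], [G x = x F_a'(x) / F_a(x)], [t] in [a^Z].
    (3) is Hieronymi's theorem: the residues [x_m] of [alpha^m] modulo [beta^Z]
    are dense in [[1, beta)].  One real codes a sparse finite set of indices [m],
    its records of approximation by the [x_m]; a second real codes one real
    number for each such [m], its position between its neighbours in
    [{x_0, ..., x_m}].  Thus approximations of [{1, ..., n}] are
    uniformly definable, and so is [Z].
    (4) [D] is real analytic on [[-1, 1]]; the functional equation extends its
    definition to bounded sets, and periodicity of [Theta] to [(1, oo)]. *)

(** * Closure properties of definable predicates and functions *)

Section Definability.
Context {R : realType} (L : set (primitive R)).
Implicit Types (P Q : (nat -> R) -> Prop) (f g : (nat -> R) -> R).

(** Predicates of the whole environment replace sets of row vectors, so that a quantifier becomes a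
    shift of variables and no formula has to be written out. *)
Definition definable P := exists phi : formula L, forall e, holds e phi <-> P e.

Lemma definable_ext P Q : (forall e, P e <-> Q e) -> definable P -> definable Q.
Proof. by move=> PQ [phi h]; exists phi => e; rewrite h PQ. Qed.

Lemma definable_not P : definable P -> definable (fun e => ~ P e).
Proof. by move=> [phi h]; exists (Not phi) => e /=; rewrite h. Qed.

Lemma definable_and P Q :
  definable P -> definable Q -> definable (fun e => P e /\ Q e).
Proof. by move=> [p hp] [q hq]; exists (And p q) => e /=; rewrite hp hq. Qed.

Lemma definable_or P Q :
  definable P -> definable Q -> definable (fun e => P e \/ Q e).
Proof.
move=> hP hQ; apply: definable_ext (definable_not
  (definable_and (definable_not hP) (definable_not hQ))) => e.
by rewrite -not_orE; split=> [/contrapT//|h]; apply.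
Qed.

Lemma definable_imp P Q :
  definable P -> definable Q -> definable (fun e => P e -> Q e).
Proof.
move=> hP hQ; apply: definable_ext (definable_or (definable_not hP) hQ) => e.
by rewrite implyE.
Qed.

Lemma definable_ex (P : R -> (nat -> R) -> Prop) :
  definable (fun e => P (e 0%N) (fun i => e i.+1)) ->
  definable (fun e => exists x, P x e).
Proof.
by move=> [phi h]; exists (Ex phi) => e /=; split=> -[x] px; exists x;
  apply/(h (push x e)).
Qed.

Lemma definable_all (P : R -> (nat -> R) -> Prop) :
  definable (fun e => P (e 0%N) (fun i => e i.+1)) ->
  definable (fun e => forall x, P x e).
Proof.
move=> /definable_not /(@definable_ex (fun x e => ~ P x e)) /definable_not.
apply: definable_ext => e.
by rewrite -forallNE; split=> h x; [apply: contrapT|move=> /(_ (h x))].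
Qed.

Definition substitutable (s : nat -> (nat -> R) -> R) :=
  forall i, exists t : term R, forall e, eval e t = s i e.

Lemma eval_subst s (t : term R) : substitutable s ->
  exists u : term R, forall e, eval e u = eval (fun i => s i e) t.
Proof.
move=> hs; elim: t => [i|r|t [u hu] t' [u' hu']|t [u hu] t' [u' hu']] /=.
- by have [u hu] := hs i; exists u => e.
- by exists (Const r).
- by exists (Add u u') => e /=; rewrite hu hu'.
- by exists (Mul u u') => e /=; rewrite hu hu'.
Qed.

Lemma definable_subst P s : substitutable s ->
  definable P -> definable (fun e => P (fun i => s i e)).
Proof.
move=> hs [phi h]; suff [psi hpsi] : exists psi : formula L,
    forall e, holds e psi <-> holds (fun i => s i e) phi.
  by exists psi => e; rewrite hpsi h.
move=> {h P}; elim: phi s hs => [t t'|p Lp t|p IH|p IH q IH'|p IH] s hs.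
- have [u hu] := eval_subst t hs; have [u' hu'] := eval_subst t' hs.
  by exists (Equal L u u') => e /=; rewrite hu hu'.
- have /choice[u hu] : forall i, exists u, forall e : nat -> R,
    eval e u = eval (fun i => s i e) (t i) by move=> i; exact: eval_subst.
  exists (Atom Lp u) => e /=; rewrite (_ : \row_i _ = \row_i eval e (u i))//.
  by apply/rowP => i; rewrite !mxE hu.
- by have [psi h] := IH s hs; exists (Not psi) => e /=; rewrite h.
- have [psi h] := IH s hs; have [psi' h'] := IH' s hs.
  by exists (And psi psi') => e /=; rewrite h h'.
- pose s' i := if i is j.+1 then fun e : nat -> R => s j (fun i => e i.+1)
               else fun e => e 0%N.
  have hs' : substitutable s'.
    case=> [|i]; first by exists (Var R 0).
    have hS : substitutable (fun i (e : nat -> R) => e i.+1).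
      by move=> j; exists (Var R j.+1).
    have [t ht] := hs i; have [u hu] := eval_subst t hS.
    by exists u => e; rewrite hu ht.
  have [psi h] := IH s' hs'.
  exists (Ex psi) => e /=; split=> -[x hx]; exists x; move: hx; rewrite h;
    congr (holds _ p); by apply/funext => -[|i].
Qed.

(** Functions such as the inverse and the norm are not terms, so a function is handled through its
    graph: variable 0 holds the value, the arguments start at 1. *)
Definition dfun f := definable (fun e => e 0%N = f (fun i => e i.+1)).

Lemma definable_rename P (r : nat -> nat) :
  definable P -> definable (fun e => P (fun i => e (r i))).
Proof.
by apply: (@definable_subst P (fun i e => e (r i))) => i; exists (Var R (r i)).
Qed.

Lemma dfun_rename f (r : nat -> nat) :
  dfun f -> dfun (fun e => f (fun i => e (r i))).
Proof.
move=> /(definable_rename (fun i => if i is j.+1 then (r j).+1 else 0%N)).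
by apply: definable_ext.
Qed.

Lemma definable_rel1 (P : R -> Prop) f :
  definable (fun e => P (e 0%N)) -> dfun f -> definable (fun e => P (f e)).
Proof.
move=> hP hf; apply: (@definable_ext (fun e => exists x, x = f e /\ P x)).
  by move=> e; split=> [[x [->]]//|h]; exists (f e).
apply: definable_ex; apply: definable_and => //.
Qed.

Lemma definable_rel2 (P : R -> R -> Prop) f g :
  definable (fun e => P (e 0%N) (e 1%N)) -> dfun f -> dfun g ->
  definable (fun e => P (f e) (g e)).
Proof.
move=> hP hf hg; apply: (@definable_ext
    (fun e => exists x, x = f e /\ exists y, y = g e /\ P x y)).
  move=> e; split=> [[x [-> [y [->]]]]//|h].
  by exists (f e); split=> //; exists (g e).
apply: definable_ex; apply: definable_and => //; apply: definable_ex.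
apply: definable_and; first exact: (@dfun_rename g (fun i => i.+1)).
exact: (definable_rename (fun i => if i == 0 then 1 else 0)%N hP).
Qed.

Lemma dfun_var i : dfun (fun e => e i).
Proof. by exists (Equal L (Var R 0) (Var R i.+1)). Qed.

Lemma dfun_cst r : dfun (fun=> r).
Proof. by exists (Equal L (Var R 0) (Const r)). Qed.

Lemma definable_eq f g : dfun f -> dfun g -> definable (fun e => f e = g e).
Proof.
by apply: definable_rel2; exists (Equal L (Var R 0) (Var R 1)).
Qed.

Lemma definable_rel3 (P : R -> R -> R -> Prop) f g h :
  definable (fun e => P (e 0%N) (e 1%N) (e 2%N)) -> dfun f -> dfun g -> dfun h ->
  definable (fun e => P (f e) (g e) (h e)).
Proof.
move=> hP hf hg hh; apply: (@definable_ext (fun e => exists x, x = f e /\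
    exists y, y = g e /\ exists z, z = h e /\ P x y z)).
  move=> e; split=> [[x [-> [y [-> [z [->]]]]]]//|?].
  by exists (f e); split=> //; exists (g e); split => //; exists (h e).
apply: definable_ex; apply: definable_and => //.
apply: definable_ex; apply: definable_and.
  exact: (@dfun_rename g (fun i => i.+1)).
apply: definable_ex; apply: definable_and.
  exact: (@dfun_rename h (fun i => i.+2)).
exact: (definable_rename (fun i => match i with 0 => 2 | 1 => 1 | _ => 0 end)%N hP).
Qed.

Lemma dfun_comp2 (F : R -> R -> R) f g :
  definable (fun e => e 2%N = F (e 0%N) (e 1%N)) -> dfun f -> dfun g ->
  dfun (fun e => F (f e) (g e)).
Proof.
move=> hF hf hg; apply: (@definable_rel3 (fun x y z => z = F x y) _ _ _ hF).
- exact: (@dfun_rename f S).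
- exact: (@dfun_rename g S).
- exact: dfun_var.
Qed.

Lemma dfun_comp1 (F : R -> R) f :
  definable (fun e => e 1%N = F (e 0%N)) -> dfun f -> dfun (fun e => F (f e)).
Proof.
move=> hF hf; apply: (@definable_rel2 (fun x y => y = F x) _ _ hF).
- exact: (@dfun_rename f S).
- exact: dfun_var.
Qed.

Lemma dfun_add f g : dfun f -> dfun g -> dfun (fun e => f e + g e).
Proof.
apply: dfun_comp2.
by exists (Equal L (Var R 2) (Add (Var R 0) (Var R 1))).
Qed.

Lemma dfun_mul f g : dfun f -> dfun g -> dfun (fun e => f e * g e).
Proof.
apply: dfun_comp2.
by exists (Equal L (Var R 2) (Mul (Var R 0) (Var R 1))).
Qed.

Lemma dfun_opp f : dfun f -> dfun (fun e => - f e).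
Proof.
apply: dfun_comp1.
by exists (Equal L (Var R 1) (Mul (Const (-1)) (Var R 0))) => e /=; rewrite mulN1r.
Qed.

Lemma dfun_exp f n : dfun f -> dfun (fun e => f e ^+ n).
Proof.
move=> hf; elim: n => [|n IH]; first exact: dfun_cst.
rewrite (_ : (fun e => f e ^+ n.+1) = (fun e => f e * f e ^+ n)).
  exact: dfun_mul.
by apply/funext => e; rewrite exprS.
Qed.

Lemma dfun_inv f : dfun f -> dfun (fun e => (f e)^-1).
Proof.
(* The inverse of 0 is 0 by convention, hence the first disjunct. *)
apply: dfun_comp1; apply: (@definable_ext (fun e =>
  (e 0%N = 0 /\ e 1%N = 0) \/ (e 0%N <> 0 /\ e 1%N * e 0%N = 1))).
  move=> e; split=> [[[-> ->]|[/eqP h h1]]|->]; first by rewrite invr0.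
    by rewrite -[LHS](mulfK h) h1 mul1r.
  have [->|h] := eqVneq (e 0%N) 0; [by left; rewrite invr0|right].
  by split; [exact/eqP|rewrite mulVf].
have d := dfun_var; have c := dfun_cst.
apply: definable_or; apply: definable_and; try exact: definable_eq.
  by apply: definable_not; exact: definable_eq.
by apply: definable_eq => //; exact: dfun_mul.
Qed.

Lemma definable_le f g : dfun f -> dfun g -> definable (fun e => f e <= g e).
Proof.
apply: (@definable_rel2 (fun x y => x <= y)).
(* The order is definable from the field operations: the difference is a square. *)
apply: (@definable_ext (fun e => exists z, e 1%N = e 0%N + z * z)).
  move=> e; split=> [[z ->]|h]; first by rewrite lerDl -expr2 sqr_ge0.
  exists (Num.sqrt (e 1%N - e 0%N)).
  by rewrite -expr2 sqr_sqrtr ?subr_ge0// addrC subrK.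
apply: definable_ex; apply: definable_eq; first exact: dfun_var.
by apply: dfun_add; [|apply: dfun_mul]; exact: dfun_var.
Qed.

Lemma definable_lt f g : dfun f -> dfun g -> definable (fun e => f e < g e).
Proof.
move=> hf hg; apply: definable_ext (definable_not (definable_le hg hf)) => e.
by rewrite ltNge; split=> [/negP|/negP].
Qed.

Lemma dfun_norm f : dfun f -> dfun (fun e => `|f e|).
Proof.
have d := dfun_var; have c := dfun_cst.
apply: dfun_comp1; apply: (@definable_ext (fun e =>
  (0 <= e 0%N /\ e 1%N = e 0%N) \/ (e 0%N < 0 /\ e 1%N = - e 0%N))).
  move=> e; split=> [[[h ->]|[h ->]]|->].
  - by rewrite ger0_norm.
  - by rewrite ltr0_norm.
  - by have [h|h] := leP 0 (e 0%N); [left; rewrite ger0_norm|right; rewrite ltr0_norm].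
apply: definable_or; apply: definable_and.
- exact: definable_le.
- exact: definable_eq.
- exact: definable_lt.
- by apply: definable_eq => //; exact: dfun_opp.
Qed.

Lemma defines_line (A : set R) :
  definable (fun e => A (e 0%N)) -> defines L (line_set A).
Proof.
move=> [phi h]; exists phi => x; rewrite h /line_set /= /env.
by case: insubP => [j _ j0|//]; rewrite (_ : j = 0)//; apply/val_inj.
Qed.

Lemma line_graph_onE (D : set R) (f : R -> R) (x : 'rV[R]_(1 + 1)) :
  line_graph_on D f x <-> D (x 0 (lshift 1 0)) /\
    x 0 (rshift 1 0) = f (x 0 (lshift 1 0)).
Proof.
rewrite /line_graph_on /graph_on /line_set; split=> [[y /= Dy <-]|[Dx xE]].
  by rewrite row_mxEl row_mxEr mxE.
exists (lsubmx x) => /=; first by rewrite mxE.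
rewrite -[RHS]hsubmxK; congr row_mx.
by apply/rowP => i; rewrite !mxE ord1 xE.
Qed.

Lemma defines_line_graph (D : set R) (f : R -> R) :
  definable (fun e => D (e 0%N) /\ e 1%N = f (e 0%N)) ->
  defines L (line_graph_on D f).
Proof.
move=> [phi h]; exists phi => x; rewrite h line_graph_onE /env.
case: insubP => [j _ j0|//]; case: insubP => [k _ k1|//].
rewrite (_ : j = lshift 1 0); last exact/val_inj.
by rewrite (_ : k = rshift 1 0)//; exact/val_inj.
Qed.

Lemma definable_line (A : set R) : L (prim (line_set A)) ->
  definable (fun e => A (e 0%N)).
Proof.
move=> LA; exists (Atom LA (fun i => Var R i)) => e /=.
by rewrite /line_set /= mxE.
Qed.

Lemma definable_line_graph (D : set R) (f : R -> R) :
  L (prim (line_graph_on D f)) ->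
  definable (fun e => D (e 0%N) /\ e 1%N = f (e 0%N)).
Proof.
move=> LA; exists (Atom LA (fun i => Var R i)) => e /=.
by rewrite line_graph_onE !mxE.
Qed.

End Definability.

(** Peels off one connective or operation. An implication is a product too, so [definable_imp] is
    tried before [definable_all]. *)
Ltac definability := match goal with
  | |- dfun _ (fun e => @?f e + @?g e) => apply: dfun_add
  | |- dfun _ (fun e => @?f e * @?g e) => apply: dfun_mul
  | |- dfun _ (fun e => - @?f e) => apply: dfun_opp
  | |- dfun _ (fun e => (@?f e)^-1) => apply: dfun_inv
  | |- dfun _ (fun e => `|@?f e|) => apply: dfun_norm
  | |- dfun _ (fun e => @?f e ^+ _) => apply: dfun_exp
  | |- dfun _ _ => first [exact: dfun_cst | exact: dfun_var]
  | |- definable _ (fun e => ~ @?P e) => apply: definable_not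
  | |- definable _ (fun e => @?P e /\ @?Q e) => apply: definable_and
  | |- definable _ (fun e => @?P e \/ @?Q e) => apply: definable_or
  | |- definable _ (fun e => exists x, @?Q x e) => apply: definable_ex
  | |- definable _ (fun e => is_true (@?P e <= @?Q e)) => apply: definable_le
  | |- definable _ (fun e => is_true (@?P e < @?Q e)) => apply: definable_lt
  | |- definable _ (fun e => @?P e = @?Q e :> _) => apply: definable_eq
  | |- definable _ (fun e => forall x, @?Q x e) =>
     first [apply: definable_imp | apply: definable_all]
  | |- definable _ (fun e => @?P e -> @?Q e) => apply: definable_imp
  end.

(** * Power series with infinite radius of convergence *)

Section EntirePowerSeries.
Context {R : realType}.
Implicit Types (u c : nat -> R) (x : R).

Lemma is_cvg_series_halving u : (forall n, 0 <= u n) ->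
  (exists N, forall k, (N <= k)%N -> 2 * u k.+1 <= u k) -> cvgn (series u).
Proof.
(* [C] bounds [u k * 2 ^+ k] for every [k]: beyond [N] this product no longer increases, and up to
   [N] it is at most [2 ^+ N] times a finite sum. *)
move=> u0 [N uN]; pose C := 2 ^+ N * \sum_(k < N.+1) u k.
have C0 : 0 <= C by rewrite mulr_ge0// sumr_ge0.
have S_ge k : (k <= N)%N -> u k <= \sum_(k < N.+1) u k.
  by move=> kN; rewrite (bigD1 (Ordinal (kN : (k < N.+1)%N)))//= lerDl sumr_ge0.
have half0 : (0 : R) <= 2^-1 by rewrite invr_ge0.
apply: (@series_le_cvg _ _ (geometric C 2^-1)) => //.
- by move=> n; apply: geometric_ge0.
- have main k : u (N + k)%N * 2 ^+ (N + k) <= C.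
    elim: k => [|k IH]; first by rewrite addn0 mulrC ler_wpM2l// S_ge.
    apply: le_trans IH; rewrite addnS exprS mulrCA mulrA ler_wpM2r ?exprn_ge0//.
    exact/uN/leq_addr.
  move=> k /=; rewrite exprVn ler_pdivlMr ?exprn_gt0//.
  have [kN|/ltnW/subnKC <-//] := leqP k N.
  rewrite mulrC; apply: ler_pM; rewrite ?exprn_ge0 ?S_ge//.
  by rewrite ler_weXn2l// ler1n.
- by apply: is_cvg_geometric_series; rewrite ger0_norm// invf_lt1// ltr1n.
Qed.

(** The ratio of consecutive coefficients tends to 0, stated without division; the condition passes
    directly to formal derivatives. *)
Definition superexp_decay c :=
  forall X, 0 < X -> exists N, forall k, (N <= k)%N -> X * `|c k.+1| <= `|c k|.

Lemma superexp_decay_diffs c : superexp_decay c -> superexp_decay (pseries_diffs c).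
Proof.
move=> hc X X0; have [|N hN] := hc (2 * X); first by rewrite mulr_gt0.
exists N => k Nk; rewrite /pseries_diffs !normrM !normr_nat.
have := hN k.+1 (leqW Nk); have : (k.+2)%:R <= 2 * (k.+1)%:R :> R.
  by rewrite -natrM ler_nat mul2n -addnn addSn addnS !ltnS leq_addr.
move=> h1 h2; apply: le_trans (ler_wpM2l (ler0n _ _) h2).
rewrite mulrCA [leRHS](_ : _ = (2 * k.+1%:R) * (X * `|c k.+2|)); last by ring.
by rewrite ler_wpM2r// mulr_ge0// ltW.
Qed.

Lemma is_cvg_pseries_superexp c x : superexp_decay c -> cvgn (pseries c x).
Proof.
move=> hc; apply: normed_cvg; apply: is_cvg_series_halving => [k|]; first exact: normr_ge0.
have [|N hN] := hc (2 * (1 + `|x|)); first by rewrite mulr_gt0// ltr_pwDl.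
exists N => k Nk /=; rewrite !normrM exprS normrM.
rewrite [leLHS](_ : _ = (2 * `|x| * `|c k.+1|) * `|x ^+ k|); last by ring.
rewrite ler_wpM2r//; apply: le_trans (hN k Nk).
by rewrite ler_wpM2r// ler_wpM2l// lerDr.
Qed.

Lemma is_derive_pseries_superexp c x : superexp_decay c ->
  is_derive x (1 : R) (fun x => limn (pseries c x))
    (limn (pseries (pseries_diffs c) x)).
Proof.
move=> hc; apply: (@pseries_snd_diffs _ c (`|x| + 1)).
- exact: is_cvg_pseries_superexp.
- by apply: is_cvg_pseries_superexp; apply: superexp_decay_diffs.
- by apply: is_cvg_pseries_superexp; do 2 apply: superexp_decay_diffs.
- by rewrite [ltRHS]ger0_norm ?addr_ge0// ltrDl.
Qed.

Lemma pseriesS c x n : pseries c x n.+1 = pseries c x n + c n * x ^+ n.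
Proof. exact: seriesSr. Qed.

Lemma cvgn_eq (u : R^nat) (l l' : R) : u @ \oo --> l -> u @ \oo --> l' -> l = l'.
Proof. by move=> /cvg_lim <-// /cvg_lim <-. Qed.

Lemma is_derive_continuous (f : R -> R) x d :
  is_derive x (1 : R) f d -> {for x, continuous f}.
Proof.
by move=> [df _]; apply: differentiable_continuous; exact/derivable1_diffP.
Qed.

End EntirePowerSeries.

(** * The entire function F_a, its zeros and its functional equation *)

Section CanonicalProduct.
Context {R : realType} (a : R) (a_gt1 : 1 < a).
Implicit Types (x : R) (n : nat).

Let a_gt0 : 0 < a. Proof. exact: lt_trans a_gt1. Qed.
Let a_neq0 : a != 0. Proof. exact: lt0r_neq0. Qed.

Lemma cvg_scaleV x : (a ^- n * x) @[n --> \oo] --> (0 : R).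
Proof.
rewrite -[X in _ --> X](mul0r x); apply: cvgMr_tmp.
under eq_fun do rewrite -exprVn.
by apply: cvg_expr; rewrite ger0_norm ?invr_ge0 ?(ltW a_gt0)// invf_lt1.
Qed.

(* Euler: F_a(x) = \sum_k x^k / ((a - 1) ... (a^k - 1)); this makes termwise
   differentiation of the infinite product unnecessary. *)
Definition euler_coef n : R := (\prod_(j < n) (a ^+ j.+1 - 1))^-1.

Lemma expr_sub1_gt0 n : 0 < a ^+ n.+1 - 1.
Proof. by rewrite subr_gt0 exprn_egt1. Qed.

Lemma euler_coefS n : euler_coef n.+1 * (a ^+ n.+1 - 1) = euler_coef n.
Proof.
by rewrite /euler_coef big_ord_recr/= invfM divfK// lt0r_neq0// expr_sub1_gt0.
Qed.

Lemma euler_coef_decay : superexp_decay euler_coef.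
Proof.
move=> X X0.
(* The ratio of consecutive coefficients is [(a ^+ k.+1 - 1)^-1], so it is enough that [a ^+ k.+1]
   exceeds [X + 1]. *)
have [N _ hN] : \forall n \near \oo, `|a ^- n * (X + 1)| < 1.
  have /cvgr0Pnorm_lt := cvg_scaleV (X + 1); exact.
exists N => k Nk; rewrite -(euler_coefS k) normrM mulrC ler_wpM2l//.
rewrite gtr0_norm ?expr_sub1_gt0// lerBrDr.
have := hN k.+1 (leqW Nk); rewrite gtr0_norm; last first.
  by rewrite mulr_gt0 ?invr_gt0 ?exprn_gt0// addr_gt0.
by rewrite ltr_pdivrMl ?exprn_gt0// mulr1 => /ltW.
Qed.

Definition euler := fun x => limn (pseries euler_coef x).

Lemma cvg_euler x : pseries euler_coef x @ \oo --> euler x.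
Proof. exact: is_cvg_pseries_superexp euler_coef_decay. Qed.

(** Comparing coefficients of [x^n] gives [a^n c_n = c_n + c_(n-1)], which is [euler_coefS]; for
    partial sums the right-hand side combines lengths [n.+1] and [n]. *)
Lemma euler_scale x : euler (a * x) = (1 + x) * euler x.
Proof.
have := @cvg_euler (a * x); rewrite -cvg_shiftS => /cvgn_eq; apply.
rewrite [X in X @ _](_ : _ = fun n =>
    pseries euler_coef x n.+1 + x * pseries euler_coef x n); last first.
  apply/funext => n /=; elim: n => [|n IH].
    by rewrite /pseries /series/= !big_nat1 big_geq// !expr0 mulr0 addr0.
  rewrite pseriesS IH !pseriesS -(euler_coefS n) exprMn !exprS.
  by move: (pseries _ _ _) => u; ring.
rewrite mulrDl mul1r; apply: cvgD; last by apply: cvgM; [exact: cvg_cst|exact: cvg_euler].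
by have := @cvg_euler x; rewrite -cvg_shiftS.
Qed.

Lemma euler0 : euler 0 = 1.
Proof.
have := @cvg_euler 0; rewrite -cvg_shiftS => /cvgn_eq; apply.
rewrite [X in X @ _](_ : _ = cst 1); first exact: cvg_cst.
apply/funext => n; rewrite /pseries /series/= big_nat_recl//= expr0 mulr1.
rewrite big1 ?addr0 /euler_coef ?big_ord0 ?invr1// => i _.
by rewrite expr0n mulr0.
Qed.

Lemma euler_continuous : continuous euler.
Proof.
move=> x; apply: is_derive_continuous; exact: is_derive_pseries_superexp euler_coef_decay.
Qed.

Lemma euler_prod x N : euler x = \prod_(1 <= n < N.+1) (1 + a ^- n * x) * euler (a ^- N * x).
Proof.
elim: N => [|N IH]; first by rewrite big_geq// mul1r expr0 invr1 mul1r.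
rewrite IH [in RHS]big_nat_recr//= -mulrA; congr (_ * _).
by rewrite -euler_scale mulrA exprS invfM mulrA mulfV// mul1r.
Qed.

(** The quotient of [euler x] by the [n]-th partial product is [euler (a ^- n * x)], which tends to
    [euler 0 = 1]. *)
Lemma F_euler x : F a x = euler x.
Proof.
apply: cvg_lim => //; rewrite -cvg_shiftS.
have EN : euler (a ^- n * x) @[n --> \oo] --> (1 : R).
  by rewrite -euler0; apply: continuous_cvg; [exact: euler_continuous|exact: cvg_scaleV].
suff : \prod_(1 <= k < n.+1) (1 + a ^- k * x) @[n --> \oo] --> euler x / 1.
  by rewrite divr1.
have nz : \forall n \near \oo, euler (a ^- n * x) != 0.
  have /cvgrPdist_lt/(_ _ ltr01) := EN; apply: filterS => n.
  by apply: contraTneq => ->; rewrite subr0 normr1 ltxx.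
apply: (@cvg_trans _ ((euler x * (euler (a ^- n * x))^-1) @[n --> \oo])).
  apply: near_eq_cvg; near=> n.
  by rewrite (euler_prod x n) mulfK//; near: n.
by apply: cvgMl_tmp; apply: cvgV => //; exact: oner_neq0.
Unshelve. all: by end_near. Qed.

Lemma F_fun : F a = euler. Proof. exact/funext/F_euler. Qed.

Lemma F_scale x : F a (a * x) = (1 + x) * F a x.
Proof. by rewrite !F_euler euler_scale. Qed.

(** The tail [euler (a ^- N * x)] is nonzero for large [N], so a zero comes from one of finitely
    many factors. Conversely the functional equation propagates the zero [- a]. *)
Lemma F_zero x : F a x = 0 <-> exists2 n, (0 < n)%N & x = - a ^+ n.
Proof.
split=> [Fx0|[[//|n _ ->]]]; last first.
  elim: n => [|n IH]; first by rewrite expr1 -mulrN1 F_scale subrr mul0r.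
  by rewrite exprS -mulrN F_scale IH mulr0.
have [N _ hN] : \forall n \near \oo, euler (a ^- n * x) != 0.
  have : euler (a ^- n * x) @[n --> \oo] --> (1 : R).
    by rewrite -euler0; apply: continuous_cvg; [exact: euler_continuous|exact: cvg_scaleV].
  move=> /cvgrPdist_lt/(_ _ ltr01); apply: filterS => n.
  by apply: contraTneq => ->; rewrite subr0 normr1 ltxx.
move: Fx0; rewrite F_euler (euler_prod x N) => /eqP; rewrite mulf_eq0.
rewrite (negbTE (hN N (leqnn N))) orbF prodf_seq_eq0 => /hasP[n].
rewrite mem_index_iota => /andP[n0 _] /= /eqP h; exists n => //.
apply: (mulfI (_ : a ^- n != 0)); first by rewrite invr_eq0 expf_neq0.
by rewrite mulrN mulVf ?expf_neq0//; lra.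
Qed.

Lemma F_neq0 x : - a < x -> F a x != 0.
Proof.
move=> ax; apply/eqP => /F_zero[[//|n] _ xE]; move: ax.
rewrite {}xE ltrN2 exprS -[X in _ < X -> _]mulr1 ltr_pM2l// => h.
by have := exprn_ege1 n (ltW a_gt1); rewrite leNgt h.
Qed.

Let E1 := fun x => limn (pseries (pseries_diffs euler_coef) x).
Let E2 := fun x => limn (pseries (pseries_diffs (pseries_diffs euler_coef)) x).

Let is_derive_F x : is_derive x (1 : R) (F a) (E1 x).
Proof. by rewrite F_fun; exact: is_derive_pseries_superexp euler_coef_decay. Qed.

Let is_derive_E1 x : is_derive x (1 : R) E1 (E2 x).
Proof. by apply: is_derive_pseries_superexp; exact/superexp_decay_diffs/euler_coef_decay. Qed.

Let E2_continuous : continuous E2.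
Proof.
move=> x; apply: is_derive_continuous.
by apply: is_derive_pseries_superexp; do 2 apply/superexp_decay_diffs; exact: euler_coef_decay.
Qed.

Let derive1_F x : derive1 (F a) x = E1 x.
Proof. by rewrite derive1E; have [_ ->] := is_derive_F x. Qed.

Let logder_E x : logder_F a x = E1 x / F a x.
Proof. by rewrite /logder_F derive1_F. Qed.

(** Both sides are the derivative of [F a (a * x) = (1 + x) * F a x]. The next lemma differentiates
    once more. *)
Let E1_scale x : a * E1 (a * x) = F a x + (1 + x) * E1 x.
Proof.
have h1 : is_derive x (1 : R) (fun x => F a (a * x)) (a * E1 (a * x)).
  have := @is_derive1_comp _ (F a) (fun x => a * x) x (E1 (a * x)) a (is_derive_F _).
  rewrite mulrC; apply.
  have : is_derive x (1 : R) (a \*: id) (a *: 1) by exact: is_deriveZ.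
  by rewrite [X in is_derive _ _ _ X -> _]mulr1.
have h2 : is_derive x (1 : R) (fun x => F a (a * x)) (F a x + (1 + x) * E1 x).
  have -> : (fun x => F a (a * x)) = (fun x => 1 + x) * F a.
    by apply/funext => y; rewrite F_scale.
  have h : is_derive x (1 : R) (cst (1 : R) + (id : R -> R)) (0 + 1).
    exact: is_deriveD.
  rewrite add0r in h.
  have := is_deriveM h (is_derive_F x).
  by congr (is_derive _ _ _ _); rewrite addrC /GRing.scale/= mulr1.
by have [_ <-] := h1; have [_ <-] := h2.
Qed.

Let E2_scale x : a ^+ 2 * E2 (a * x) = E1 x *+ 2 + (1 + x) * E2 x.
Proof.
have h1 : is_derive x (1 : R) (fun x => a * E1 (a * x)) (a * (E2 (a * x) * a)).
  have := @is_derive1_comp _ E1 (fun x => a * x) x (E2 (a * x)) a (is_derive_E1 _).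
  have : is_derive x (1 : R) (a \*: id) (a *: 1) by exact: is_deriveZ.
  rewrite [X in is_derive _ _ _ X -> _]mulr1 => h /(_ h) {}h.
  exact: (@is_deriveZ _ _ _ _ a _ _ _ h).
have h2 : is_derive x (1 : R) (fun x => a * E1 (a * x)) (E1 x *+ 2 + (1 + x) * E2 x).
  have -> : (fun x => a * E1 (a * x)) =
      F a + (cst (1 : R) + (id : R -> R)) * E1.
    by apply/funext => y; rewrite E1_scale.
  have h : is_derive x (1 : R) (cst (1 : R) + (id : R -> R)) (0 + 1).
    exact: is_deriveD.
  rewrite add0r in h.
  have := is_deriveD (is_derive_F x) (is_deriveM h (is_derive_E1 x)).
  by congr (is_derive _ _ _ _); rewrite /GRing.scale/= mulr1 mulr2n addrCA addrC.
by have [_ <-] := h2; have [_ ->] := h1; rewrite mulrCA mulrC -expr2 mulrC.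
Qed.

(** The value of [(x F'/F)'] given by the quotient rule; it stands for [xlogder_F'] only where
    [F a x != 0]. *)
Let D x := E1 x / F a x + x * (E2 x / F a x - (E1 x / F a x) ^+ 2).

Let is_derive_xlogder_D x : F a x != 0 ->
  is_derive x (1 : R) (fun x => x * logder_F a x) (D x).
Proof.
move=> Fx; have -> : (fun x => x * logder_F a x) =
    (id : R -> R) * (E1 * (fun y => (F a y)^-1)).
  by apply/funext => y; rewrite logder_E.
have dF := is_derive_F x; have [dF1 dF2] := dF.
have hV : is_derive x (1 : R) (fun y => (F a y)^-1) (- (F a x) ^- 2 *: E1 x).
  by apply: DeriveDef; [exact: derivableV|rewrite deriveV// dF2].
have := is_deriveM (is_derive_id x (1 : R)) (is_deriveM (is_derive_E1 x) hV).
congr (is_derive _ _ _ _); rewrite /D /GRing.scale/= -[(E1 * _) x]/(E1 x * (F a x)^-1).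
by field.
Qed.

Let xlogder_D x : F a x != 0 -> xlogder_F' a x = D x.
Proof.
by move=> Fx; rewrite /xlogder_F' derive1E; have [_ ->] := is_derive_xlogder_D Fx.
Qed.

Lemma is_derive_xlogder x : F a x != 0 ->
  is_derive x (1 : R) (fun x => x * logder_F a x) (xlogder_F' a x).
Proof. by move=> Fx; rewrite xlogder_D//; exact: is_derive_xlogder_D. Qed.

Lemma xlogder_continuous x : F a x != 0 -> {for x, continuous (xlogder_F' a)}.
Proof.
move=> Fx; have cF : {for x, continuous (F a)} := is_derive_continuous (is_derive_F x).
have c1 : {for x, continuous E1} := is_derive_continuous (is_derive_E1 x).
have cD : {for x, continuous D}.
  rewrite /D; apply: cvgD.
    by apply: cvgM => //; apply: cvgV.
  apply: cvgM; first exact: cvg_id.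
  apply: cvgB; first by apply: cvgM; [exact: E2_continuous|exact: cvgV].
  by rewrite expr2; apply: cvgM; apply: cvgM => //; apply: cvgV.
rewrite /prop_for /continuous_at xlogder_D//.
apply: cvg_trans cD; apply: near_eq_cvg.
have : \forall y \near x, `|F a x - F a y| < `|F a x|.
  by move/cvgrPdist_lt : cF; apply; rewrite normr_gt0.
apply: filterS => y h; rewrite xlogder_D//; apply: contraTneq h => ->.
by rewrite subr0 ltxx.
Qed.

Lemma F_scale_neq0 x : F a (a * x) != 0 -> 1 + x != 0 /\ F a x != 0.
Proof. by rewrite F_scale mulf_eq0 negb_or => /andP. Qed.

Lemma logder_scale x : F a (a * x) != 0 ->
  a * x * logder_F a (a * x) = x / (1 + x) + x * logder_F a x.
Proof.
move=> /F_scale_neq0[x1 Fx]; rewrite !logder_E F_scale.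
rewrite (_ : a * x * _ = x * (a * E1 (a * x)) / ((1 + x) * F a x)); last first.
  by rewrite !mulrA [a * x]mulrC.
by rewrite E1_scale; field; rewrite Fx.
Qed.

Lemma xlogder_scale x : F a (a * x) != 0 ->
  a * xlogder_F' a (a * x) = (1 + x) ^- 2 + xlogder_F' a x.
Proof.
move=> FX; have [x1 Fx] := F_scale_neq0 FX; rewrite !xlogder_D// /D.
rewrite (_ : a * _ = (a * E1 (a * x)) / F a (a * x) +
  x * (a ^+ 2 * E2 (a * x) / F a (a * x) - (a * E1 (a * x) / F a (a * x)) ^+ 2)).
  rewrite E1_scale E2_scale F_scale; field.
  by rewrite Fx.
by field.
Qed.

Lemma F_contract_neq0 x n : F a x != 0 -> F a (a ^- n * x) != 0.
Proof.
by rewrite !F_euler (euler_prod x n) mulf_eq0 negb_or => /andP[].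
Qed.

Lemma add_expr_neq0 x n : F a x != 0 -> (0 < n)%N -> a ^+ n + x != 0.
Proof.
by move=> /eqP Fx n0; apply/eqP => h; apply: Fx; apply/F_zero; exists n => //; lra.
Qed.

Lemma xlogder_sum x N : F a x != 0 -> xlogder_F' a x =
  \sum_(0 <= n < N) a ^+ n.+1 / (a ^+ n.+1 + x) ^+ 2 +
  a ^- N * xlogder_F' a (a ^- N * x).
Proof.
move=> Fx; elim: N => [|N IH].
  by rewrite big_geq// add0r expr0 invr1 !mul1r.
apply: (etrans IH); rewrite big_nat_recr; last by [].
rewrite -[RHS]addrA; congr (_ + _).
have -> : a ^- N * x = a * (a ^- N.+1 * x).
  by rewrite mulrA exprS invfM mulrA mulfV// mul1r.
have := F_contract_neq0 N.+1 Fx.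
have := F_contract_neq0 N Fx; have := add_expr_neq0 Fx (ltn0Sn N).
have -> : a ^- N * x = a * (a ^- N.+1 * x).
  by rewrite mulrA exprS invfM mulrA mulfV// mul1r.
move=> h1 h2 h3; apply: (mulfI (expf_neq0 N.+1 a_neq0)).
have aN : a ^+ N != 0 by rewrite expf_neq0.
rewrite [LHS](_ : _ = a * xlogder_F' a (a * (a ^- N.+1 * x))); last first.
  by rewrite exprS -mulrA; congr (_ * _); rewrite mulrA mulfV// mul1r.
rewrite xlogder_scale// mulrDr [X in _ = _ + X]mulrA mulfV ?expf_neq0// mul1r.
congr (_ + _); have aN1 : a ^+ N.+1 != 0 by rewrite expf_neq0.
have -> : 1 + a ^- N.+1 * x = (a ^+ N.+1 + x) / a ^+ N.+1.
  by rewrite mulrDl mulfV// mulrC.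
move: (a ^+ N.+1) aN1 h1 => t t0 tx.
by field; rewrite t0 tx.
Qed.

(** The remainder of [xlogder_sum] tends to [0 * xlogder_F' a 0] by continuity at 0, so the series
    needs no termwise differentiation. *)
Lemma cvg_xlogder x : F a x != 0 ->
  series (fun n => a ^+ n.+1 / (a ^+ n.+1 + x) ^+ 2) @ \oo --> xlogder_F' a x.
Proof.
move=> Fx; have -> : series (fun n => a ^+ n.+1 / (a ^+ n.+1 + x) ^+ 2) =
    (fun N => xlogder_F' a x - a ^- N * xlogder_F' a (a ^- N * x)).
  by apply/funext => N; rewrite /series/= (xlogder_sum N Fx) addrK.
suff : xlogder_F' a x - a ^- N * xlogder_F' a (a ^- N * x) @[N --> \oo] -->
    xlogder_F' a x - 0 * xlogder_F' a 0 by rewrite mul0r subr0.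
apply: cvgB; first exact: cvg_cst.
apply: cvgM.
  by have := cvg_scaleV 1; under eq_fun do rewrite mulr1.
have F0 : F a 0 != 0 by rewrite F_euler euler0 oner_neq0.
by apply: continuous_cvg; [exact: xlogder_continuous|exact: cvg_scaleV].
Qed.

End CanonicalProduct.

(** * Multiplicative periods of the asymptotic function Theta *)

Section Periods.
Context {R : realType} (a : R) (a_gt1 : 1 < a).
Implicit Types (x z t : R) (f g : R -> R).

Let a_gt0 : 0 < a. Proof. exact: lt_trans a_gt1. Qed.
Let a_neq0 : a != 0. Proof. exact: lt0r_neq0. Qed.

Lemma exprz_floor t : 0 < t -> exists k : int, a ^ k <= t < a ^ (k + 1).
Proof.
move=> t0.
have ex y : exists n, y < a ^+ n.
  have /cvgr0Pnorm_lt/(_ _ ltr01)[N _ hN] := cvg_scaleV a_gt1 y.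
  exists N; have := hN N (leqnn _).
  move=> /(le_lt_trans (ler_norm _)).
  by rewrite ltr_pdivrMl ?exprn_gt0// mulr1.
have [N hN] := ex t^-1.
have tN : 1 <= t * a ^+ N.
  by rewrite -(mulfV (lt0r_neq0 t0)) ler_pM2l// ltW.
have /ex_minnP[n hn nmin] := ex (t * a ^+ N).
case: n hn nmin => [|n] hn nmin.
  by move: (le_lt_trans tN hn); rewrite expr0 ltxx.
have hn' : a ^+ n <= t * a ^+ N.
  by rewrite leNgt; apply/negP => /nmin; rewrite ltnn.
have e m : a ^ (m%:Z - N%:Z) = a ^+ m / a ^+ N by rewrite expfzDr// -exprnN.
exists (n%:Z - N%:Z).
rewrite (_ : n%:Z - N%:Z + 1 = n.+1%:Z - N%:Z); last by lia.
by rewrite !e ler_pdivrMr ?exprn_gt0// ltr_pdivlMr ?exprn_gt0// hn'.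
Qed.

(** The middle term of [Theta]; it is invariant under [x |-> x^-1], behaves like [x] at 0 and like
    [x^-1] at infinity, and has its strict maximum 1/4 at 1. *)
Definition kern (x : R) : R := x / (1 + x) ^+ 2.

Lemma kern_gt0 x : 0 < x -> 0 < kern x.
Proof. by move=> x0; rewrite divr_gt0// exprn_gt0// addr_gt0. Qed.

(** [kern y - kern x] has the sign of [(y - x) * (1 - x * y)], so one lemma covers the increase on
    [(0, 1]] and the decrease on [[1, oo)]. *)
Lemma ler_kern x y : 0 < x -> 0 < y -> 0 <= (y - x) * (1 - x * y) ->
  kern x <= kern y.
Proof.
move=> x0 y0 h; have hx : 0 < 1 + x by rewrite addr_gt0.
have hy : 0 < 1 + y by rewrite addr_gt0.
rewrite ler_pdivrMr ?exprn_gt0// mulrAC ler_pdivlMr ?exprn_gt0// -subr_ge0.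
by rewrite (_ : _ - _ = (y - x) * (1 - x * y))//; ring.
Qed.

Lemma kern_lt x : 0 < x -> x != 1 -> 4 * kern x < 1.
Proof.
move=> x0 x1; rewrite mulrA ltr_pdivrMr ?exprn_gt0 ?addr_gt0// mul1r -subr_gt0.
rewrite (_ : _ - _ = (x - 1) ^+ 2); last by ring.
by rewrite lt0r sqrf_eq0 subr_eq0 x1 sqr_ge0.
Qed.

(** As [kern] is unimodal, only the two lattice points adjacent to 1 count, and neither of them is
    1. *)
Lemma kern_lattice_lt t : 0 < t -> (forall k : int, t != a ^ k) ->
  exists2 rho, 0 <= rho < 1 & forall k : int, 4 * kern (a ^ k / t) <= rho.
Proof.
move=> t0 tk; have [k0 /andP[k1 k2]] := exprz_floor t0.
have q0 k : 0 < a ^ k / t by rewrite divr_gt0// exprz_gt0.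
have q1 k : a ^ k / t != 1.
  by apply: contra (tk k) => /eqP h; rewrite -[t]mul1r -h divfK// lt0r_neq0.
have mon i j : (i <= j)%R -> a ^ i / t <= a ^ j / t.
  by move=> ij; rewrite ler_pM2r ?invr_gt0// ler_weXz2l// ltW.
exists (Num.max (4 * kern (a ^ k0 / t)) (4 * kern (a ^ (k0 + 1) / t))).
  rewrite le_max gt_max !kern_lt// !andbT.
  by rewrite mulr_ge0// ltW// kern_gt0.
move=> k; rewrite le_max !ler_pM2l//; have [kk|kk] := leP k k0; apply/orP.
- left; apply: ler_kern => //; apply: mulr_ge0; first by rewrite subr_ge0 mon.
  have h0 : a ^ k0 / t <= 1 by rewrite ler_pdivrMr// mul1r.
  rewrite subr_ge0; apply: mulr_ile1 => //; try exact: ltW.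
  by apply: le_trans h0; exact: mon.
- right; apply: ler_kern => //; apply: mulr_le0.
    by rewrite subr_le0 mon// -ltzD1 // ltrD2r.
  have h0 : 1 <= a ^ (k0 + 1) / t by rewrite ler_pdivlMr// mul1r ltW.
  rewrite subr_le0; apply: mulr_ege1 => //.
  by apply: le_trans h0 _; apply: mon; rewrite lezD1.
Qed.

Definition dominated f := exists K, forall x, 0 < x -> `|f x| <= K * kern x.

(* The sum of f over a^Z / t, the exponents n.+1 and - n being taken together. *)
Definition lattice_term t f (n : nat) : R := f (a ^+ n.+1 / t) + f (a ^- n / t).
Definition lattice_sum t f : R := limn (series (lattice_term t f)).

Lemma dominatedZ k f : dominated f -> dominated (k \*: f).
Proof.
move=> [K hK]; exists (`|k| * K) => x x0 /=.
by rewrite normrM -mulrA ler_wpM2l// hK.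
Qed.

Lemma dominatedD f g : dominated f -> dominated g -> dominated (f \+ g).
Proof.
move=> [K hK] [K' hK']; exists (K + K') => x x0 /=.
by rewrite mulrDl (le_trans (ler_normD _ _))// lerD ?hK ?hK'.
Qed.

Lemma dominated_kern : dominated kern.
Proof. by exists 1 => x x0; rewrite mul1r ger0_norm// ltW// kern_gt0. Qed.

Let lat1 n t : 0 < t -> 0 < a ^+ n / t.
Proof. by move=> t0; rewrite divr_gt0// exprn_gt0. Qed.
Let lat2 n t : 0 < t -> 0 < a ^- n / t.
Proof. by move=> t0; rewrite divr_gt0// invr_gt0 exprn_gt0. Qed.

Lemma is_cvg_lattice_kern t : 0 < t -> cvgn (series (lattice_term t kern)).
Proof.
move=> t0.
apply: (@series_le_cvg _ _ (geometric (t + t^-1) (a^-1))).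
- by move=> n; rewrite addr_ge0// ltW// kern_gt0// (lat1, lat2).
- by move=> n; rewrite mulr_ge0 ?exprn_ge0 ?addr_ge0 ?invr_ge0 ?(ltW t0) ?(ltW a_gt0).
- move=> n; rewrite /lattice_term/= mulrDl exprVn; apply: lerD; last first.
    rewrite /kern [leRHS]mulrC ler_pdivrMr ?exprn_gt0 ?addr_gt0 ?lat2//.
    by rewrite ler_peMr ?(ltW (lat2 _ _))// exprn_ege1// lerDl ltW// lat2.
  have x0 := lat1 n.+1 t0.
  have h : kern (a ^+ n.+1 / t) <= (a ^+ n.+1 / t)^-1.
    move: (a ^+ n.+1 / t) x0 => x x0.
    rewrite ler_pdivrMr ?exprn_gt0 ?addr_gt0// mulrC ler_pdivlMr// -expr2.
    by rewrite lerXn2r ?nnegrE ?addr_ge0 ?lerDr ?(ltW x0).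
  apply: (le_trans h); rewrite invf_div ler_pM2l// lef_pV2 ?posrE ?exprn_gt0//.
  by rewrite ler_weXn2l// ltW.
- apply: is_cvg_geometric_series.
  by rewrite ger0_norm ?invr_ge0 ?(ltW a_gt0)// invf_lt1.
Qed.

Lemma is_cvg_lattice t f : 0 < t -> dominated f -> cvgn (series (lattice_term t f)).
Proof.
move=> t0 [K hK]; apply: normed_cvg.
apply: (@series_le_cvg _ _ (K \*: lattice_term t kern)).
- by move=> n /=.
- move=> n; rewrite /= /lattice_term /GRing.scale/= mulrDr addr_ge0//.
    exact: le_trans (hK _ (lat1 _ t0)).
  exact: le_trans (hK _ (lat2 _ t0)).
- move=> n; rewrite /= /lattice_term /GRing.scale/= mulrDr.
  by rewrite (le_trans (ler_normD _ _))// lerD// hK// (lat1, lat2).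
- by apply: is_cvg_seriesZ; exact: is_cvg_lattice_kern.
Qed.

Lemma lattice_sumD t f g : 0 < t -> dominated f -> dominated g ->
  lattice_sum t (f \+ g) = lattice_sum t f + lattice_sum t g.
Proof.
move=> t0 hf hg; rewrite /lattice_sum -lim_seriesD; try exact: is_cvg_lattice.
congr (limn (series _)); apply/funext => n; rewrite /lattice_term /=.
by rewrite addrACA.
Qed.

Lemma lattice_sumZ t k f : 0 < t -> dominated f ->
  lattice_sum t (k \*: f) = k * lattice_sum t f.
Proof.
move=> t0 hf; have := lim_seriesZ k (is_cvg_lattice t0 hf).
rewrite /lattice_sum [X in _ = X -> _]/GRing.scale/= => <-.
congr (limn (series _)); apply/funext => n; rewrite /lattice_term/=.
by rewrite scalerDr.
Qed.

Lemma ler_lattice_sum t f g : 0 < t -> dominated f -> dominated g ->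
  (forall k : int, f (a ^ k / t) <= g (a ^ k / t)) ->
  lattice_sum t f <= lattice_sum t g.
Proof.
move=> t0 hf hg fg; apply: lim_series_le; try exact: is_cvg_lattice.
move=> n; apply: lerD; first exact: (fg n.+1).
by have := fg (- n%:Z); rewrite -exprnN.
Qed.

Lemma lattice_sum_ge1 f : dominated f -> (forall x, 0 < x -> 0 <= f x) ->
  f 1 <= lattice_sum 1 f.
Proof.
move=> hf f0.
have := @nondecreasing_cvgn_le _ (series (lattice_term 1 f)) _
  (is_cvg_lattice ltr01 hf) 1%N.
have pos n : 0 <= lattice_term 1 f n by rewrite addr_ge0// f0// (lat1,lat2).
have nd : nondecreasing_seq (series (lattice_term 1 f)).
  by apply/nondecreasing_seqP => n; rewrite seriesSr lerDl.
(* The term of index 0 is [f a + f 1]. *)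
move=> /(_ nd); apply: le_trans; rewrite /series/= big_nat1 /lattice_term expr0 invr1 !mulr1.
by rewrite lerDr f0// exprn_gt0.
Qed.

Section EqualMoments.
Variables (t : R) (t_gt0 : 0 < t).

(** A linear functional, continuous for the weight [kern] by [Delta_bound]; differentiation in [z]
    can thus be carried through it. *)
Let Delta f := lattice_sum 1 f - lattice_sum t f.

Let DeltaD f g : dominated f -> dominated g -> Delta (f \+ g) = Delta f + Delta g.
Proof. by move=> hf hg; rewrite /Delta !lattice_sumD//; ring. Qed.

Let DeltaZ k f : dominated f -> Delta (k \*: f) = k * Delta f.
Proof. by move=> hf; rewrite /Delta !lattice_sumZ//; ring. Qed.

Let W := lattice_sum 1 kern + lattice_sum t kern.

Let Delta_bound K f : dominated f -> (forall x, 0 < x -> `|f x| <= K * kern x) ->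
  `|Delta f| <= K * W.
Proof.
move=> hf hK; have dk := dominated_kern.
have B u : 0 < u -> `|lattice_sum u f| <= K * lattice_sum u kern.
  move=> u0; rewrite ler_norml -mulNr -!lattice_sumZ//.
  have p k : 0 < a ^ k / u by rewrite divr_gt0// exprz_gt0.
  apply/andP; split; apply: ler_lattice_sum => //; try exact: dominatedZ;
    move=> k; have := hK _ (p k); rewrite ler_norml => /andP[h1 h2] //.
  by rewrite -mulNr in h1.
by rewrite mulrDr (le_trans (ler_normB _ _))// lerD ?B.
Qed.

(** Up to a constant factor, the [k]-th derivative of [x / (x + z) ^+ 2] in [z]. *)
Let phi k z x : R := x / (x + z) ^+ k.+2.

Let phi_dominated k z : 1 <= z -> forall x, 0 < x -> `|phi k z x| <= 1 * kern x.
Proof.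
move=> z1 x x0; have z0 : 0 < z := lt_le_trans ltr01 z1.
have xz : 0 < x + z by rewrite addr_gt0.
rewrite mul1r ger0_norm; last by rewrite divr_ge0 ?exprn_ge0// ltW.
have x1 : 1 + x <= x + z by rewrite addrC lerD2l.
rewrite ler_pM2l// lef_pV2 ?posrE ?exprn_gt0 ?addr_gt0//.
apply: (@le_trans _ _ ((x + z) ^+ 2)).
  by rewrite lerXn2r ?nnegrE ?addr_ge0 ?(ltW x0) ?(ltW z0).
by rewrite ler_weXn2l// (le_trans _ x1)// lerDl ltW.
Qed.

(* r = 1/y and s = 1/(y+h); the remainder of the first-order expansion of y^(-p). *)
Let invpow_taylor (r s h : R) p : 0 <= s -> s <= r -> r <= 1 -> 0 <= h ->
  r - s = h * r * s -> (0 < p)%N ->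
  `|r ^+ p - s ^+ p - h * p%:R * r ^+ p.+1| <= p%:R ^+ 2 * h ^+ 2 * r ^+ 2.
Proof.
move=> s0 sr r1 h0 rs; have r0 := le_trans s0 sr.
have diff q : 0 <= r ^+ q.+1 - s ^+ q.+1 <= q.+1%:R * h * r ^+ 2.
  elim: q => [|q /andP[IH1 IH2]].
    by rewrite !expr1 subr_ge0 sr rs mul1r -mulrA ler_wpM2l// expr2 ler_wpM2l.
  have -> : r ^+ q.+2 - s ^+ q.+2 = r * (r ^+ q.+1 - s ^+ q.+1) + s ^+ q.+1 * (r - s).
    by rewrite ![_ ^+ q.+2]exprS; ring.
  rewrite (_ : q.+2%:R = q.+1%:R + 1 :> R); last by rewrite natr1.
    apply/andP; split.
      by rewrite addr_ge0// mulr_ge0// ?exprn_ge0// subr_ge0.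
    move: (q.+1%:R) IH2 => P IH2; rewrite !mulrDl mul1r.
  apply: lerD; first by apply: le_trans IH2; rewrite ler_piMl.
  apply: (@le_trans _ _ (r - s)).
    by rewrite ler_piMl ?subr_ge0// exprn_ile1// (le_trans sr).
  by rewrite rs -mulrA ler_wpM2l// expr2 ler_wpM2l.
case: p => // p _; elim: p => [|p IH].
  rewrite !expr1 (_ : _ - _ = - (h * r) * (r - s)); last first.
    by apply/eqP; rewrite -subr_eq0 (_ : _ - _ = (r - s) - h * r * s);
      [rewrite rs subrr|ring].
  rewrite rs normrM normrN !ger0_norm ?mulr_ge0// expr1n mul1r.
  rewrite [leLHS](_ : _ = h ^+ 2 * r ^+ 2 * s); last by ring.
  by rewrite ler_piMr ?mulr_ge0 ?exprn_ge0// (le_trans sr).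
have -> : r ^+ p.+2 - s ^+ p.+2 - h * p.+2%:R * r ^+ p.+3 =
    r * (r ^+ p.+1 - s ^+ p.+1 - h * p.+1%:R * r ^+ p.+2) -
    h * r * (r ^+ p.+2 - s ^+ p.+2).
  rewrite (_ : p.+2%:R = p.+1%:R + 1 :> R); last by rewrite natr1.
  rewrite ![_ ^+ p.+3]exprS ![_ ^+ p.+2]exprS.
  move: (s ^+ p.+1) (r ^+ p.+1) (p.+1%:R) => S T P; apply/eqP; rewrite -subr_eq0.
  by rewrite (_ : _ - _ = S * (r - s) - S * (h * r * s)); [rewrite rs subrr|ring].
have /andP[d1 d2] := diff p.+1.
rewrite (le_trans (ler_normB _ _))// !normrM (ger0_norm r0) (ger0_norm h0).
rewrite (ger0_norm d1).
apply: (@le_trans _ _ (p.+1%:R ^+ 2 * h ^+ 2 * r ^+ 2 + h * (p.+2%:R * h * r ^+ 2))).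
  apply: lerD.
    by apply: le_trans IH; rewrite ler_piMl.
  rewrite -mulrA ler_wpM2l//; apply: le_trans d2; by rewrite ler_piMl.
rewrite (_ : _ + _ = (p.+1%:R ^+ 2 + p.+2%:R) * h ^+ 2 * r ^+ 2); last by ring.
rewrite !ler_wpM2r ?exprn_ge0// -natrX -natrD -natrX ler_nat.
by rewrite -!mulnn [(p.+2 * _)%N]mulSn addnC leq_add2l leq_mul2l leqnSn orbT.
Qed.

Hypothesis Delta0 : forall z, 0 < z -> Delta (fun x => x / (x + z) ^+ 2) = 0.

Let DeltaB f g : dominated f -> dominated g ->
  Delta (fun x => f x - g x) = Delta f - Delta g.
Proof.
move=> hf hg; rewrite -[- Delta g]mulN1r -DeltaZ// -DeltaD//; last exact: dominatedZ.
by congr Delta; apply/funext => x /=; rewrite scaleN1r.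
Qed.

(** Differentiation under the sum: the values at [z] and [z + h] vanish by induction, so
    [h * Delta (phi k.+1 z)] is, up to a constant, [Delta] of the Taylor error, of order [h ^+ 2].
    Taking [h > 0] keeps [z + h >= 1]. *)
Let Delta_phi k z : 1 <= z -> Delta (phi k z) = 0.
Proof.
elim: k z => [|k IH] z z1; first by rewrite /phi Delta0// (lt_le_trans _ z1).
have dom j y : 1 <= y -> dominated (phi j y) by exists 1; exact: phi_dominated.
have W0 : 0 <= W.
  rewrite addr_ge0//; (apply: limr_ge; first exact: is_cvg_lattice_kern);
  by near=> n; rewrite sumr_ge0// => i _; rewrite addr_ge0// ltW// kern_gt0// (lat1, lat2).
have P0 : (0 : R) < k.+2%:R by rewrite ltr0n.
have key h : 0 < h -> k.+2%:R * `|Delta (phi k.+1 z)| <= k.+2%:R ^+ 2 * W * h.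
  move=> h0; have zh : 1 <= z + h by rewrite (le_trans z1)// lerDl ltW.
  pose err x := phi k z x - phi k (z + h) x - (h * k.+2%:R) * phi k.+1 z x.
  have derr : Delta err = - (h * k.+2%:R) * Delta (phi k.+1 z).
    have dz : dominated ((h * k.+2%:R) \*: phi k.+1 z) by exact/dominatedZ/dom.
    have dd : dominated (fun x => phi k z x - phi k (z + h) x).
      have := dominatedD (dom k z z1) (dominatedZ (-1) (dom k _ zh)).
      by congr dominated; apply/funext => x /=; rewrite scaleN1r.
    have -> : Delta err = Delta (fun x => phi k z x - phi k (z + h) x) -
        Delta ((h * k.+2%:R) \*: phi k.+1 z) by exact: DeltaB dd dz.
    rewrite DeltaB; [|exact: dom|exact: dom].
    by rewrite DeltaZ; [rewrite !IH//; ring|exact: dom].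
  have err_le x : 0 < x -> `|err x| <= (k.+2%:R ^+ 2 * h ^+ 2) * kern x.
    move=> x0; have xz : 1 <= x + z by rewrite (le_trans z1)// lerDr ltW.
    have z0 : 0 < z := lt_le_trans ltr01 z1.
    have y0 : 0 < x + z := lt_le_trans ltr01 xz.
    have yh0 : 0 < x + z + h by rewrite addr_gt0.
    have := @invpow_taylor (x + z)^-1 (x + z + h)^-1 h k.+2.
    rewrite invr_ge0 (ltW yh0) lef_pV2 ?posrE// lerDl (ltW h0) invf_le1// xz.
    move=> /(_ isT isT isT isT) H.
    have {}H := H _ isT.
    rewrite /err /phi [X in `|X|](_ : _ = x * ((x + z)^-1 ^+ k.+2 -
      (x + z + h)^-1 ^+ k.+2 - h * k.+2%:R * (x + z)^-1 ^+ k.+3)); last first.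
      by rewrite !exprVn addrA; ring.
    rewrite normrM gtr0_norm// /kern [leRHS]mulrCA ler_pM2l//.
    apply: (le_trans (H _)).
      by field; rewrite !lt0r_neq0.
    rewrite ler_pM2l ?mulr_gt0 ?exprn_gt0// exprVn lef_pV2 ?posrE ?exprn_gt0 ?addr_gt0//.
    by rewrite lerXn2r ?nnegrE ?addr_ge0 ?(ltW x0) ?(ltW z0)// addrC lerD2l.
  have dom_err : dominated err by exists (k.+2%:R ^+ 2 * h ^+ 2).
  have := Delta_bound dom_err err_le.
  have -> : `|Delta err| = h * (k.+2%:R * `|Delta (phi k.+1 z)|).
    by rewrite derr normrM normrN (gtr0_norm (mulr_gt0 h0 P0)) mulrA.
  rewrite [leRHS](_ : _ = h * (k.+2%:R ^+ 2 * W * h)); last by ring.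
  by rewrite ler_pM2l.
apply/eqP; rewrite -normr_le0 -(pmulr_rle0 _ P0); apply/ler_addgt0Pr => e e0.
rewrite add0r; pose K := k.+2%:R ^+ 2 * W + 1.
have K0 : 0 < K by rewrite ltr_wpDl// mulr_ge0.
apply: le_trans (key (e / K) _) _; first by rewrite divr_gt0.
rewrite mulrA ler_pdivrMr// mulrC ler_pM2l// lerDl//.
Unshelve. all: by end_near. Qed.

(** Since [kern x = (1 + x)^-1 - (1 + x) ^- 2], a factor [kern] turns into a difference of two
    functions of the same shape with higher [j]. Domination is carried along because [DeltaB]
    requires it. *)
Let Delta_kern_pow N j : Delta (fun x => x / (1 + x) ^+ j.+2 * kern x ^+ N) = 0 /\
  dominated (fun x => x / (1 + x) ^+ j.+2 * kern x ^+ N).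
Proof.
elim: N j => [|N IH] j.
  have -> : (fun x => x / (1 + x) ^+ j.+2 * kern x ^+ 0) = phi j 1.
    by apply/funext => x; rewrite expr0 mulr1 addrC.
  by split; [exact: Delta_phi|exists 1; exact: phi_dominated].
pose f i x := x / (1 + x) ^+ i.+2 * kern x ^+ N.
suff -> : Delta (fun x => x / (1 + x) ^+ j.+2 * kern x ^+ N.+1) =
    Delta (fun x => f j.+1 x - f j.+2 x).
  have [e1 d1] := IH j.+1; have [e2 d2] := IH j.+2.
  rewrite DeltaB// e1 e2 subrr; split=> //.
  have [_ [K hK]] := IH j; exists K => x x0; apply: le_trans (hK x x0).
  rewrite [kern x ^+ N.+1]exprSr mulrA normrM ler_piMr// ger0_norm ?(ltW (kern_gt0 x0))//.
  rewrite ler_pdivrMr ?mul1r ?exprn_gt0 ?addr_gt0//.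
  by rewrite sqrrD; nra.
congr (_ - _); congr (limn (series _)); apply/funext => n;
  congr (_ + _); rewrite /f [kern _ ^+ N.+1]exprSr.
all: match goal with |- _ * (_ * kern ?y) = _ => have y0 : 0 < y by rewrite ?(lat1, lat2) end.
all: match goal with |- _ * (_ * kern ?y) = _ => move: y y0 => x x0 end.
all: have x1 : 1 + x != 0 by rewrite lt0r_neq0// addr_gt0.
all: move: (kern x ^+ N) => T; rewrite /kern ![(1 + x) ^+ j.+4]exprS.
all: rewrite ![(1 + x) ^+ j.+3]exprS ![(1 + x) ^+ j.+2]exprS.
all: have xj : (1 + x) ^+ j.+1 != 0 by rewrite expf_neq0.
all: by move: ((1 + x) ^+ j.+1) xj => S S0; field; rewrite S0.
Qed.

Lemma lattice_of_equal_moments : exists k : int, t = a ^ k.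
Proof.
apply: contrapT => /forallNP nt.
have [|rho /andP[rho0 rho1] hrho] := kern_lattice_lt t_gt0.
  by move=> k; apply/eqP/nt.
(* [om N 1 = 4^-1] because [4 * kern 1 = 1], while at the points [a ^ k / t] the factor [4 * kern]
   is at most [rho < 1]. *)
pose om N x := kern x * (4 * kern x) ^+ N.
have om_dom N : dominated (om N) /\ Delta (om N) = 0.
  have [e d] := Delta_kern_pow N 0.
  have -> : om N = 4 ^+ N \*: (fun x => x / (1 + x) ^+ 2 * kern x ^+ N).
    by apply/funext => x; rewrite /om exprMn mulrCA.
  by rewrite DeltaZ// e mulr0; split=> //; exact: dominatedZ.
have bound N : 4^-1 <= rho ^+ N * lattice_sum t kern.
  have [d /eqP] := om_dom N; rewrite subr_eq0 => /eqP e.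
  have <- : om N 1 = 4^-1.
    rewrite /om /kern (_ : 1 + 1 = 2 :> R)//.
    rewrite (_ : 4 * (1 / 2 ^+ 2) = 1 :> R); last by field.
    by rewrite expr1n mulr1 div1r; congr (_^-1); rewrite expr2; ring.
  apply: (@le_trans _ _ (lattice_sum 1 (om N))).
    apply: lattice_sum_ge1 => // x x0; have := kern_gt0 x0 => k0.
    by rewrite /om mulr_ge0 ?(ltW k0)// exprn_ge0// mulr_ge0// ltW.
  rewrite e -lattice_sumZ//; last exact: dominated_kern.
  apply: ler_lattice_sum => //; first exact/dominatedZ/dominated_kern.
  move=> k; have q0 : 0 < a ^ k / t by rewrite divr_gt0// exprz_gt0.
  rewrite /om mulrC ler_pM2r ?kern_gt0//.
  have w0 := kern_gt0 q0; rewrite lerXn2r ?nnegrE//.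
  by rewrite mulr_ge0// ltW.
have : (4^-1 : R) <= 0.
  have c : (fun N => rho ^+ N * lattice_sum t kern) @ \oo --> 0 * lattice_sum t kern.
    by apply: cvgM; [apply: cvg_expr; rewrite ger0_norm|exact: cvg_cst].
  rewrite mul0r in c; have /cvg_lim <- := c => //.
  by apply: limr_ge; [apply/cvg_ex; exists 0|near=> N].
by rewrite invr_le0 lern0.
Unshelve. all: by end_near. Qed.

End EqualMoments.

Let D := xlogder_F' a.

(* The periodic function sum_{n in Z} a^n x / (a^n + x)^2, folded so that only
   values of (x F'/F)' at positive points occur. *)
Definition Theta x : R := x * D x + x^-1 * D x^-1 + kern x.

Lemma F_gt_neq0 x : 0 < x -> F a x != 0.
Proof. by move=> x0; apply: (F_neq0 a_gt1); rewrite (lt_trans _ x0)// oppr_lt0. Qed.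

Lemma xlogder_scale_pos x : 0 < x -> a * x * D (a * x) = x * D x + kern x.
Proof.
move=> x0; have ax0 : 0 < a * x by rewrite mulr_gt0.
have e := xlogder_scale a_gt1 (F_gt_neq0 ax0).
by rewrite mulrAC /D e /kern; ring.
Qed.

Lemma kernV x : 0 < x -> kern x^-1 = kern x.
Proof.
move=> x0; rewrite /kern; have x1 := lt0r_neq0 x0.
have h : 1 + x != 0 by rewrite lt0r_neq0// addr_gt0.
have h' : x + 1 != 0 by rewrite addrC.
by field; rewrite ?x1 ?h ?h'.
Qed.

(** Scaling adds [kern x] to the first summand and removes [kern ((a * x)^-1) = kern (a * x)] from
    the second; the last summand makes up for the change. *)
Lemma Theta_scale x : 0 < x -> Theta (a * x) = Theta x.
Proof.
move=> x0; have ax0 : 0 < a * x by rewrite mulr_gt0.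
rewrite /Theta xlogder_scale_pos//.
have := @xlogder_scale_pos (a * x)^-1; rewrite invr_gt0 => /(_ ax0).
rewrite [a * _^-1](_ : _ = x^-1); last by rewrite invfM mulrA mulfV ?mul1r.
by move=> ->; rewrite kernV//; ring.
Qed.

Lemma Theta_scaleX n x : 0 < x -> Theta (a ^+ n * x) = Theta x.
Proof.
move=> x0; elim: n => [|n IH]; first by rewrite mul1r.
by rewrite exprS -mulrA Theta_scale ?mulr_gt0 ?exprn_gt0.
Qed.

Lemma Theta_scalez (k : int) x : 0 < x -> Theta (a ^ k * x) = Theta x.
Proof.
move=> x0; case: k => n; first exact: Theta_scaleX.
rewrite NegzE -exprnN -[RHS](_ : Theta (a ^+ n.+1 * (a ^- n.+1 * x)) = _).
  by rewrite Theta_scaleX// mulr_gt0// invr_gt0 exprn_gt0.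
by rewrite mulrA mulfV ?expf_neq0// mul1r.
Qed.

(** The positive exponents sum to [D z]; inversion of [x] and [z] turns the negative ones into the
    series of [D z^-1]; the exponent 0 yields [kern z / z]. *)
Lemma cvg_Theta z : 0 < z ->
  series (lattice_term 1 (fun x => x / (x + z) ^+ 2)) @ \oo --> Theta z / z.
Proof.
move=> z0; have z1 := lt0r_neq0 z0; pose f x := x / (x + z) ^+ 2.
have -> : series (lattice_term 1 f) =
    series (fun n => a ^+ n.+1 / (a ^+ n.+1 + z) ^+ 2) \+ series (fun n => f (a ^- n)).
  apply/funext => n /=; rewrite /series/= -big_split/=; apply: eq_bigr => i _.
  by rewrite /lattice_term !divr1.
have -> : Theta z / z = D z + (z^-1 * D z^-1 * z^-1 + f 1).
  by rewrite /Theta /f /kern !mulrDl mulrAC mulfV// mul1r; field;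
    rewrite z1 lt0r_neq0// addr_gt0.
apply: cvgD; first exact: (cvg_xlogder a_gt1 (F_gt_neq0 z0)).
rewrite -cvg_shiftS /=.
rewrite (_ : (fun _ => _) = (fun n => z^-1 *
    series (fun n => a ^+ n.+1 / (a ^+ n.+1 + z^-1) ^+ 2) n * z^-1 + f 1)); last first.
  apply/funext => n; rewrite /series/= big_nat_recl//= expr0 invr1 addrC; congr (_ + _).
  rewrite mulr_sumr mulr_suml; apply: eq_bigr => i _; rewrite /f.
  have A0 : 0 < a ^+ i.+1 by rewrite exprn_gt0.
  have A1 := lt0r_neq0 A0; move: (a ^+ i.+1) A0 A1 => A A0 A1.
  field; rewrite A1 z1 !lt0r_neq0// addr_gt0// ?mulr_gt0//.
apply: cvgD; last exact: cvg_cst.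
apply: cvgM; last exact: cvg_cst; apply: cvgM; first exact: cvg_cst.
by apply: (cvg_xlogder a_gt1); apply: F_gt_neq0; rewrite invr_gt0.
Qed.

Lemma lattice_sum_Theta t z : 0 < t -> 0 < z ->
  lattice_sum t (fun x => x / (x + z) ^+ 2) = Theta (t * z) / z.
Proof.
move=> t0 z0; apply: cvg_lim => //; have t1 := lt0r_neq0 t0.
have tz : 0 < t * z by rewrite mulr_gt0.
have -> : Theta (t * z) / z = t * (Theta (t * z) / (t * z)).
  by field; rewrite t1 lt0r_neq0.
have -> : series (lattice_term t (fun x => x / (x + z) ^+ 2)) =
    (fun n => t * series (lattice_term 1 (fun x => x / (x + t * z) ^+ 2)) n).
  apply/funext => n; rewrite /series/= mulr_sumr; apply: eq_bigr => i _.
  rewrite /lattice_term !divr1 mulrDr.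
  have step y : 0 < y -> y / t / (y / t + z) ^+ 2 = t * (y / (y + t * z) ^+ 2).
    move=> y0; field; rewrite t1 !lt0r_neq0 ?addr_gt0 ?mulr_gt0//.
  by rewrite !step ?invr_gt0 ?exprn_gt0.
by apply: cvgM; [exact: cvg_cst|exact: cvg_Theta].
Qed.

Lemma Theta_period t : 0 < t -> (forall x, 0 < x -> Theta (t * x) = Theta x) ->
  exists k : int, t = a ^ k.
Proof.
move=> t0 h; apply: lattice_of_equal_moments => // z z0.
by rewrite !lattice_sum_Theta// mul1r h// subrr.
Qed.

(** The limit is spelled out with [e] and [M] because it is to be read as a first-order formula. *)
Definition tends_pinfty (f : R -> R) (l : R) :=
  forall e, 0 < e -> exists M, forall x, M < x -> `|f x - l| < e.

Lemma tends_pinfty_Theta : tends_pinfty (fun x => Theta x - x * D x) 0.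
Proof.
move=> e e0.
have F0 : F a 0 != 0 by apply: (F_neq0 a_gt1); rewrite oppr_lt0.
have /cvgrPdist_lt/(_ _ ltr01) := xlogder_continuous a_gt1 F0.
(* [C] collects [|D x^-1| < |D 0| + 1], valid for large [x], and [kern x <= x^-1]: the difference is
   at most [C / x]. *)
move=> [d /= d0 hd]; pose C := `|D 0| + 2.
have C0 : 0 < C by rewrite ltr_wpDl.
exists (Num.max d^-1 (C / e)) => x; rewrite gt_max => /andP[dx ex].
have x0 : 0 < x by rewrite (lt_trans _ dx)// invr_gt0.
have xV : 0 < x^-1 by rewrite invr_gt0.
have Dx : `|D x^-1| < `|D 0| + 1.
  have := hd x^-1; rewrite /= sub0r normrN gtr0_norm// => /(_ _).
  rewrite -[X in _ < X]invrK ltf_pV2 ?posrE ?invr_gt0// => /(_ dx) h.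
  rewrite -ltrBlDl; apply: le_lt_trans h; rewrite distrC.
  exact: lerB_dist.
have kx : kern x <= x^-1.
  rewrite ler_pdivrMr ?exprn_gt0 ?addr_gt0// mulrC ler_pdivlMr// -expr2.
  by rewrite lerXn2r ?nnegrE ?addr_ge0 ?lerDr ?(ltW x0).
rewrite subr0 (_ : Theta x - x * D x = x^-1 * D x^-1 + kern x); last first.
  by rewrite /Theta; ring.
rewrite (le_lt_trans (ler_normD _ _))// normrM gtr0_norm//.
rewrite (ger0_norm (ltW (kern_gt0 x0))).
apply: (@lt_le_trans _ _ (x^-1 * (`|D 0| + 1) + x^-1)).
  by rewrite ltr_leD// ltr_pM2l.
rewrite (_ : _ + _ = x^-1 * C); last by rewrite /C; ring.
by rewrite ler_pdivrMl// mulrC -ler_pdivrMl// mulrC ltW.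
Qed.

(** [Theta] does not change along [a ^+ n * x], which tends to infinity; hence an equality of
    [Theta (t * x)] and [Theta x] that holds asymptotically holds exactly. *)
Lemma xlogder_period t : 0 < t ->
  tends_pinfty (fun x => t * x * D (t * x) - x * D x) 0 <-> exists k : int, t = a ^ k.
Proof.
move=> t0; split=> [h|[k tk] e e0]; last first.
  have e2 : 0 < e / 2 by rewrite divr_gt0.
  have [M hM] := tends_pinfty_Theta e2.
  exists (Num.max 0 (Num.max M (M / t))) => x; rewrite !gt_max => /and3P[x0 Mx Mtx].
  have := hM x Mx; have := hM (t * x).
  rewrite -ltr_pdivrMl// [_^-1 * M]mulrC => /(_ Mtx).
  rewrite {1}tk Theta_scalez// !subr0 => h1 h2.
  rewrite [e]splitr.
  rewrite [X in `|X|](_ : _ = (Theta x - x * D x) - (Theta x - t * x * D (t * x))).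
    by rewrite (le_lt_trans (ler_normB _ _))// ltrD.
  by ring.
apply: Theta_period => // x x0; apply/eqP; rewrite -subr_eq0 -normr_le0.
apply/ler_addgt0Pr => e e0; rewrite add0r.
have e3 : 0 < e / 3 by rewrite divr_gt0.
have [M hM] := tends_pinfty_Theta e3; have [M' hM'] := h _ e3.
have [n hn] : exists n, Num.max M (Num.max (M / t) M') < a ^+ n * x.
  have [k /andP[_ kM]] := @exprz_floor ((1 + `|Num.max M (Num.max (M / t) M')|) / x)
    (divr_gt0 (ltr_pwDl ltr01 (normr_ge0 _)) x0).
  exists (absz (k + 1)); rewrite -ltr_pdivrMr//; apply: (@lt_le_trans _ _ (a ^ (k + 1))).
    apply: le_lt_trans kM; rewrite ler_pM2r ?invr_gt0//.
    by rewrite (le_trans (ler_norm _))// lerDr.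
  by rewrite exprnP ler_weXz2l ?(ltW a_gt1)// lez_abs.
move: hn; rewrite !gt_max => /and3P[h1 h2 h3].
rewrite -(Theta_scaleX n x0) -(Theta_scaleX n (mulr_gt0 t0 x0)) mulrCA.
set y := a ^+ n * x in h1 h2 h3 *.
have := hM _ h1; have := hM' _ h3; have := hM (t * y).
rewrite -ltr_pdivrMl// [_^-1 * M]mulrC => /(_ h2); rewrite !subr0 => k1 k2 k3.
rewrite [X in `|X|](_ : _ = (Theta (t * y) - t * y * D (t * y)) +
  (t * y * D (t * y) - y * D y) - (Theta y - y * D y)); last by ring.
rewrite (le_trans (ler_normB _ _))//.
rewrite (_ : e = e / 3 + e / 3 + e / 3); last by field.
apply: lerD; last exact: ltW.
apply: le_trans (ler_normD _ _) _.
by apply: lerD; apply: ltW; [exact: k1|exact: k2].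
Qed.

End Periods.

(** * Coding finite sequences of reals by a dense sequence *)

Section Coding.
Context {R : realType} (x : nat -> R) (lo hi : R).
Hypothesis x0_lo : x 0 = lo.
Hypothesis x_dense : forall u v, lo <= u -> u < v -> v <= hi ->
  exists m, u < x m < v.

Definition record (c : R) (m : nat) :=
  x m < c /\ forall e, (e < m)%N -> ~ (x m <= x e /\ x e < c).

(* y lies between the adjacent points p and q of {x 0, ..., x m}. *)
Definition bracket (m : nat) (y p q : R) :=
  [/\ exists2 e, (e <= m)%N & x e = p, exists2 e, (e <= m)%N & x e = q, p <= y, y < q &
    forall e, (e <= m)%N -> ~ (p < x e /\ x e < q)].

Lemma bracket_uniq m y p q p' q' :
  bracket m y p q -> bracket m y p' q' -> p = p' /\ q = q'.
Proof.
have aux : forall p q p' q', bracket m y p q -> bracket m y p' q' -> p' <= p /\ q <= q'.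
  move=> {}p {}q {}p' {}q' [_ _ py yq h] [[e em ep] [f fm fq] p'y yq' _].
  split; rewrite leNgt; apply/negP => lt.
    by apply: (h e em); rewrite ep; split=> //; exact: le_lt_trans yq.
  by apply: (h f fm); rewrite fq; split=> //; exact: le_lt_trans yq'.
move=> b b'; have [h1 h2] := aux _ _ _ _ b b'; have [h3 h4] := aux _ _ _ _ b' b.
by split; apply/le_anti/andP.
Qed.

Lemma next_point N p : (exists2 e, (e <= N)%N & p < x e) ->
  exists e, [/\ (e <= N)%N, p < x e & forall f, (f <= N)%N -> ~ (p < x f /\ x f < x e)].
Proof.
elim: N => [|N IH] [e eN pe].
  exists e; split=> // f; rewrite leqn0 => /eqP ->.
  by move: eN pe; rewrite leqn0 => /eqP -> _ []; rewrite ltxx.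
have [/IH[g [gN pg hg]]|no] := pselect (exists2 e, (e <= N)%N & p < x e).
  have [h|h] := ltP (x N.+1) (x g); last first.
    exists g; split=> //; first exact: leqW.
    move=> f; rewrite leq_eqVlt => /orP[/eqP ->|]; last exact: hg.
    by move=> [_]; rewrite ltNge h.
  have [h'|h'] := ltP p (x N.+1).
    exists N.+1; split=> // f; rewrite leq_eqVlt => /orP[/eqP ->|].
      by rewrite ltxx => -[].
    by move=> /hg k [? /lt_trans k']; apply: k; split=> //; exact: k'.
  exists g; split=> //; first exact: leqW.
  move=> f; rewrite leq_eqVlt => /orP[/eqP ->|]; last exact: hg.
  by move=> [/lt_le_trans/(_ h')]; rewrite ltxx.
exists N.+1; have eN1 : e = N.+1.
  apply/eqP; move: eN; rewrite leq_eqVlt => /orP[//|eN].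
  by case: no; exists e.
split=> //; first by rewrite -eN1.
move=> f; rewrite leq_eqVlt => /orP[/eqP ->|fN [pf _]]; first by rewrite ltxx => -[].
by apply: no; exists f.
Qed.

(** Restricting the coding number to [(c1, c)] postpones its next record beyond index [N]. *)
Lemma gap_above N c1 c2 : c1 < c2 -> exists2 c, c1 < c <= c2 &
  forall e, (e <= N)%N -> ~ (c1 < x e /\ x e < c).
Proof.
move=> c12; have [/next_point[e [eN ce he]]|no] :=
    pselect (exists2 e, (e <= N)%N & c1 < x e).
  exists (Num.min c2 (x e)); first by rewrite lt_min c12 ce ge_min lexx.
  move=> f fN [cf]; rewrite lt_min => /andP[_ fe].
  by apply: (he f fN).
exists c2; first by rewrite c12 lexx.
by move=> e eN [ce _]; apply: no; exists e.
Qed.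

(* c is chosen so that its records up to M form a sparse set m_1 < ... < m_n,
   and then y so that its position in the gap around it at stage m_k is close
   to v k: enlarging c slightly delays the next record until the points x e
   are dense in the interval still allowed for y. *)
Lemma coding_sequence (v : nat -> R) eps n : 0 < eps -> (forall k, 0 < v k < 1) ->
  lo < hi ->
  exists M c1 c2 y1 y2, [/\ [&& lo <= c1, c1 < c2 & c2 <= hi],
    [&& lo <= y1, y1 < y2 & y2 <= hi],
    exists2 e, (e <= M)%N & x e = c1,
    forall e, (e <= M)%N -> ~ (c1 < x e /\ x e < c2) &
    forall c y, c1 < c < c2 -> y1 < y < y2 ->
      (forall m p q, (m <= M)%N -> record c m -> bracket m y p q ->
        exists2 k, (k < n)%N & `|(y - p) - v k * (q - p)| < eps * (q - p)) /\
      (forall k, (k < n)%N -> exists m p q, [/\ (m <= M)%N, record c m,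
        bracket m y p q & `|(y - p) - v k * (q - p)| < eps * (q - p)])].
Proof.
move=> eps0 v01 lohi; elim: n => [|n].
  (* Index 0 is a record, but it codes nothing: a single point has no bracket. *)
  exists 0, lo, hi, lo, hi; split; try by rewrite !lexx lohi.
  - by exists 0.
  - by move=> e; rewrite leqn0 => /eqP ->; rewrite x0_lo ltxx => -[].
  - move=> c y _ _; split=> // m p q; rewrite leqn0 => /eqP -> _ [].
    move=> [e] + ep [f] + fq py yq _; rewrite !leqn0 => /eqP e0 /eqP f0.
    by move: (le_lt_trans py yq); rewrite -ep -fq e0 f0 ltxx.
move=> [M [c1 [c2 [y1 [y2 [/and3P[lc1 c12 c2h] /and3P[ly1 y12 y2h] [e0 e0M e0c] nogap H]]]]]].
have ymid : y1 < (y1 + y2) / 2 < y2 by rewrite midf_lt// midf_lt.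
have [ym1 ym2] := andP ymid.
(* Two points of the sequence inside [(y1, y2)] guarantee a gap contained in it, once the next
   record is delayed beyond [m1] and [m2]. *)
have [m1 /andP[m1a m1b]] := x_dense ly1 ym1 (le_trans (ltW ym2) y2h).
have [m2 /andP[m2a m2b]] := x_dense (le_trans ly1 (ltW ym1)) ym2 y2h.
pose N := maxn M (maxn m1 m2).
have [c2' /andP[cc' c'c] gapN] := gap_above N c12.
have exM : exists m, (c1 < x m < c2').
  by apply: x_dense => //; exact: le_trans c2h.
(* [M'] is the first index whose point lies in [(c1, c2')], hence the next record of every [c] in
   [(x M', c2')]. *)
have /ex_minnP[M' /andP[M'1 M'2] M'min] := exM.
have NM' : (N < M')%N.
  by rewrite ltnNge; apply/negP => h; apply: (gapN M' h).
have MM' : (M < M')%N by apply: leq_ltn_trans NM'; rewrite leq_max leqnn.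
have m1M' : (m1 <= M')%N by rewrite ltnW// (leq_ltn_trans _ NM')// !leq_max leqnn orbT.
have m2M' : (m2 <= M')%N by rewrite ltnW// (leq_ltn_trans _ NM')// !leq_max leqnn !orbT.
have [q [qM' pq hq]] : exists e, [/\ (e <= M')%N, x m1 < x e &
    forall f, (f <= M')%N -> ~ (x m1 < x f /\ x f < x e)].
  by apply: next_point; exists m2 => //; exact: lt_trans m2a.
have qy2 : x q < y2.
  have [h|h] := ltP (x m2) (x q); last exact: le_lt_trans m2b.
  by case: (hq m2 m2M'); split=> //; exact: lt_trans m2a.
set p := x m1 in pq hq *; set qq := x q in pq hq qy2.
have qp0 : 0 < qq - p by rewrite subr_gt0.
have /andP[vn0 vn1] := v01 n.
(* Relative positions within [eps] of [v n], cut off to [[0, 1]] so that [y] stays in the gap. *)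
pose w1 := Num.max 0 (v n - eps); pose w2 := Num.min 1 (v n + eps).
have w12 : w1 < w2.
  by rewrite /w1 /w2 lt_min !gt_max ltr01/=; apply/and3P; split; lra.
exists M', (x M'), c2', (p + w1 * (qq - p)), (p + w2 * (qq - p)); split.
- by rewrite (le_trans lc1 (ltW M'1)) M'2 (le_trans c'c).
- apply/and3P; split.
  + apply: (@le_trans _ _ p); first by rewrite (le_trans ly1)// ltW.
    by rewrite lerDl mulr_ge0 ?(ltW qp0)// /w1 le_max lexx.
  + by rewrite ltrD2l ltr_pM2r.
  + apply: (@le_trans _ _ qq); last by rewrite (le_trans (ltW qy2)).
    rewrite -lerBrDl ler_piMl ?(ltW qp0)// /w2 ge_min lexx//.
- by exists M'.
- move=> e eM' [ce ec']; have : (c1 < x e < c2') by rewrite ec' (lt_trans M'1).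
  move=> /M'min M'e; have eE : e = M' by apply/eqP; rewrite eqn_leq eM' M'e.
  by move: ce; rewrite eE ltxx.
move=> c y /andP[cM' cc2'] /andP[yw1 yw2].
have c12' : c1 < c < c2 by rewrite (lt_trans M'1 cM') (lt_le_trans cc2').
have pw1 : p <= p + w1 * (qq - p).
  by rewrite lerDl mulr_ge0 ?(ltW qp0)// /w1 le_max lexx.
have pw2 : p + w2 * (qq - p) <= qq.
  by rewrite -lerBrDl ler_piMl ?(ltW qp0)// /w2 ge_min lexx.
have py : p < y := le_lt_trans pw1 yw1.
have yq : y < qq := lt_le_trans yw2 pw2.
have y12' : y1 < y < y2 by rewrite (lt_trans m1a)// (lt_trans yq).
have [Ha Hb] := H c y c12' y12'.
have br : bracket M' y p qq.
  by split=> //; [exists m1|exists q|exact: ltW].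
have recM' : record c M'.
  split=> // e eM' [h1 h2]; have : c1 < x e < c2'.
    by rewrite (lt_le_trans M'1)//= (lt_trans h2).
  by move=> /M'min; rewrite leqNgt eM'.
have good : `|(y - p) - v n * (qq - p)| < eps * (qq - p).
  have k1 : (v n - eps) * (qq - p) < y - p.
    rewrite ltrBrDl; apply: le_lt_trans yw1; rewrite lerD2l ler_pM2r//.
    by rewrite /w1 le_max lexx orbT.
  have k2 : y - p < (v n + eps) * (qq - p).
    rewrite ltrBlDl; apply: (lt_le_trans yw2); rewrite lerD2l ler_pM2r//.
    by rewrite /w2 ge_min lexx orbT.
  rewrite ltr_norml; move: k1 k2; rewrite mulrBl mulrDl; lra.
split.
- move=> m p' q' mM' rec brm; have [mM|Mm] := leqP m M.
    by have [k kn hk] := Ha m p' q' mM rec brm; exists k => //; exact: ltnW.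
  move: mM'; rewrite leq_eqVlt => /orP[/eqP mE|mM'].
    rewrite mE in brm; have [<- <-] := bracket_uniq br brm.
    by exists n.
  (* An index strictly between [M] and [M'] is no record: either its point is at most [c1 = x e0],
     which came earlier, or it contradicts the minimality of [M']. *)
  case: rec => xmc hm; have [xm1|xm1] := leP (x m) c1.
    case: (hm e0); first exact: leq_ltn_trans Mm.
    by rewrite e0c xm1; split=> //; exact: lt_trans cM'.
  have : c1 < x m < c2' by rewrite xm1 (lt_trans xmc).
  by move=> /M'min; rewrite leqNgt mM'.
- move=> k; rewrite ltnS leq_eqVlt => /orP[/eqP ->|kn].
    by exists M', p, qq; split.
  have [m [p' [q' [mM r b g]]]] := Hb k kn.
  by exists m, p', q'; split=> //; exact: leq_trans (ltnW MM').
Qed.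

End Coding.

(** * Characterization of the positive integers through coded sets *)

Section NaturalNumbersFromDenseSequence.
Context {R : realType} (X : R -> R -> Prop).

(** First-order versions of [record] and [bracket]: in the intended use [X d v] says that [v] is the
    point with code [d], and codes are ordered like indices. *)
Definition rec_at (c d : R) := exists v, [/\ X d v, v < c &
  forall d' v', X d' v' -> d' < d -> ~ (v <= v' /\ v' < c)].

Definition bracket_at (d y p q : R) :=
  [/\ exists2 d', X d' p & d' <= d, exists2 d', X d' q & d' <= d, p <= y, y < q &
    forall d' v, X d' v -> d' <= d -> ~ (p < v /\ v < q)].

(** [z / K] is the relative position of [y] in its gap at a record of [c]; in the intended use [b]
    leaves only finitely many codes. *)
Definition coded (c y b K z : R) := exists d p q,
  [/\ d <= b, rec_at c d, bracket_at d y p q & z * (q - p) = K * (y - p)].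

(* The coded sets that look like {1, ..., n} up to errors that remain small
   when summed. *)
Definition near_natural (w : R) := forall eps, 0 < eps -> exists c y b K,
  [/\ 1 <= K, exists2 z, coded c y b K z & `|z - w| < eps &
    forall z, coded c y b K z -> `|z - 1| * K < eps \/
      exists2 z', coded c y b K z' & `|z - z' - 1| * K < eps].

Lemma coded_bounds c y b K z : 0 < K -> coded c y b K z -> 0 <= z < K.
Proof.
move=> K0 [d [p [q [_ _ [_ _ py yq _] e]]]].
have qp : 0 < q - p by rewrite subr_gt0 (le_lt_trans py).
rewrite -(pmulr_lge0 _ qp) -(ltr_pM2r qp) e ltr_pM2l// ltrD2r yq andbT.
by rewrite mulr_ge0 ?subr_ge0// ltW.
Qed.

(** Starting near [w], descend from each coded [z] to some [z'] close to [z - 1]. Coded elements lie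
    in [[0, K)] and a step errs by less than [e / K], so the total error stays of order [e]. *)
Lemma near_natural_nat w : near_natural w -> exists n : nat, w = n.+1%:R.
Proof.
move=> H.
have H1 eps : 0 < eps -> exists n : nat, `|w - n.+1%:R| < eps.
  (* The bound 1/4 makes every step longer than 1/2; the bound [eps / 3] leaves room for [2 * e]
     from the descent and [e] from the start. *)
  move=> eps0; pose e := Num.min (4^-1) (eps / 3).
  have e0 : 0 < e by rewrite lt_min divr_gt0// invr_gt0 ltr0n.
  have [c [y [b [K [K1 [z zS zw] HS]]]]] := H e e0.
  have K0 : 0 < K := lt_le_trans ltr01 K1.
  have e4 : e <= 4^-1 by rewrite ge_min lexx.
  have e3 : e <= eps / 3 by rewrite ge_min lexx orbT.
  (* The bound is linear in [z]: a step of length at least 1/2 lowers the right-hand side by at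
     least [e], which pays for its error. The induction is on a bound for [2 * z]. *)
  suff claim : forall N z, 2 * z < N%:R -> coded c y b K z ->
      exists n : nat, `|z - n.+1%:R| * K <= 2 * e * z.
    have /andP[z0 zK] := coded_bounds K0 zS.
    have [N hN] : exists N : nat, 2 * z < N%:R.
      by exists (Num.bound (2 * z)); apply: archi_boundP; rewrite mulr_ge0.
    have [n hn] := claim N z hN zS; exists n.
    have h2 : `|z - n.+1%:R| <= 2 * e.
      rewrite -(ler_pM2r K0); apply: (le_trans hn).
      by rewrite ler_pM2l ?mulr_gt0// ltW.
    have -> : w - n.+1%:R = (z - n.+1%:R) - (z - w) by ring.
    by rewrite (le_lt_trans (ler_normB _ _))//; lra.
  have small (t : R) : `|t| * K < e -> `|t| < e.
    by apply: le_lt_trans; rewrite ler_peMr.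
  elim=> [|N IH] {zS zw}z zN zS; have /andP[z0 zK] := coded_bounds K0 zS.
    by move: zN; lra.
  have [h|[z' z'S h]] := HS z zS.
    exists 0%N; apply: (le_trans (ltW h)); have := small _ h.
    rewrite ltr_norml => /andP[h1 h2].
    have : 2^-1 <= z by lra.
    by move: e0 => e0 zh; rewrite mulrAC ler_peMl ?(ltW e0)//; lra.
  have /andP[z'0 z'K] := coded_bounds K0 z'S.
  have := small _ h; rewrite ltr_norml => /andP[h1 h2].
  have [n hn] : exists n : nat, `|z' - n.+1%:R| * K <= 2 * e * z'.
    by apply: IH => //; move: zN; rewrite -natr1; lra.
  exists n.+1; have -> : z - n.+2%:R = (z - z' - 1) + (z' - n.+1%:R).
    by rewrite -natr1; ring.
  apply: (@le_trans _ _ ((`|z - z' - 1| + `|z' - n.+1%:R|) * K)).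
    by rewrite ler_pM2r// ler_normD.
  rewrite mulrDl; apply: (@le_trans _ _ (e + 2 * e * z')).
    by rewrite lerD// ltW.
  have : 0 <= e * (2 * (z - z') - 1) by rewrite mulr_ge0 ?(ltW e0)//; lra.
  by lra.
(* Approximations within 1/3 determine the integer, so the one found here serves for every smaller
   precision. *)
have [n hn] := H1 3^-1 (ltac:(by rewrite invr_gt0)).
exists n; apply/eqP; rewrite -subr_eq0 -normr_le0; apply/ler_addgt0Pr => e e0.
rewrite add0r; have [m] := H1 (Num.min 3^-1 e) (ltac:(by rewrite lt_min e0 andbT invr_gt0)).
rewrite lt_min => /andP[hm1 hm2].
suff -> : n = m by exact: ltW.
apply/eqP/negPn/negP => nm.
have : (1 : R) <= `|n.+1%:R - m.+1%:R|.
  have : 1 <= `|(n.+1%:Z - m.+1%:Z)| by lia.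
  by rewrite -(ler_int R) intr_norm rmorphB/= -!pmulrn.
have := ler_normB (w - m.+1%:R) (w - n.+1%:R).
rewrite (_ : _ - _ = n.+1%:R - m.+1%:R :> R); last by ring.
by move: hn hm1; lra.
Qed.

Lemma nat_near_natural (u x : nat -> R) (lo hi : R) :
  (forall m n, (u m < u n) = (m < n)%N) -> x 0%N = lo -> lo < hi ->
  (forall c1 c2, lo <= c1 -> c1 < c2 -> c2 <= hi -> exists m, c1 < x m < c2) ->
  (forall d v, X d v <-> exists2 m, d = u m & v = x m) ->
  forall n : nat, near_natural n.+1%:R.
Proof.
move=> u_lt x0 lohi dense XE n eps eps0.
have u_le i j : (u i <= u j) = (i <= j)%N by rewrite leNgt u_lt -leqNgt.
have Xu m : X (u m) (x m) by apply/XE; exists m.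
have recE c m : rec_at c (u m) <-> record x c m.
  split=> [[v [/XE[m' um ->] vc h]]|[xc h]].
    have -> : m = m' by apply/eqP; rewrite eqn_leq -!u_le um lexx.
    split=> // e em'; apply: (h (u e)); first exact: Xu.
    by rewrite um u_lt.
  exists (x m); split=> // d' v' /XE[m' -> ->]; rewrite u_lt; exact: h.
have brE m y p q : bracket_at (u m) y p q <-> bracket x m y p q.
  split=> -[].
    move=> [d' /XE[e -> ->]] em [f' /XE[f -> ->]] fm py yq h.
    rewrite !u_le in em fm.
    split=> //; [by exists e|by exists f|].
    by move=> g gm; apply: (h (u g)); rewrite ?u_le.
  move=> [e em <-] [f fm <-] py yq h; split=> //.
  - by exists (u e); rewrite ?u_le.
  - by exists (u f); rewrite ?u_le.
  - by move=> d' v /XE[g -> ->]; rewrite u_le; exact: h.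
pose K : R := n.+2%:R; have K0 : 0 < K by rewrite ltr0n.
have K1 : 1 <= K by rewrite ler1n.
(* Scaling by [K] turns these targets into 1, ..., n+1; the value 1/2 beyond them only keeps [v] in
   [(0, 1)]. *)
pose v k : R := if (k < n.+1)%N then k.+1%:R / K else 2^-1.
have v01 k : 0 < v k < 1.
  rewrite /v; case: ifPn => kn; last by rewrite invr_gt0 invf_lt1 ?ltr1n ?ltr0n.
  by rewrite divr_gt0 ?ltr0n// ltr_pdivrMr// mul1r ltr_nat !ltnS.
(* One factor [K] is lost in passing from positions to [z] and another in [near_natural]; the 2
   allows for a difference of two errors. *)
pose delta := eps / (2 * K ^+ 2).
have delta0 : 0 < delta by rewrite divr_gt0// mulr_gt0// exprn_gt0.
have [M [c1 [c2 [y1 [y2 [/and3P[_ c12 _] /and3P[_ y12 _] _ _ H]]]]]] :=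
  coding_sequence x0 dense n.+1 delta0 v01 lohi.
have [//|//|Ha Hb] := H ((c1 + c2) / 2) ((y1 + y2) / 2); try by rewrite !midf_lt.
set c := (c1 + c2) / 2 in Ha Hb; set y := (y1 + y2) / 2 in Ha Hb.
have dK : delta * K * K = eps / 2.
  by rewrite /delta; field; rewrite lt0r_neq0.
have conv k z p q : (k < n.+1)%N -> p <= y -> y < q -> z * (q - p) = K * (y - p) ->
    `|(y - p) - v k * (q - p)| < delta * (q - p) -> `|z - k.+1%:R| < delta * K.
  move=> kn py yq e; have qp : 0 < q - p by rewrite subr_gt0 (le_lt_trans py).
  rewrite /v kn => hk; rewrite -(ltr_pM2r qp) -{1}(gtr0_norm qp) -normrM mulrBl e.
  rewrite (_ : _ - _ = K * ((y - p) - k.+1%:R / K * (q - p))); last first.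
    by field; rewrite lt0r_neq0.
  rewrite normrM (gtr0_norm K0) [ltRHS](_ : _ = K * (delta * (q - p))); last by ring.
  by rewrite ltr_pM2l.
have codedE z : coded c y (u M) K z -> exists2 k, (k < n.+1)%N & `|z - k.+1%:R| < delta * K.
  move=> [d [p [q [dM rc br e]]]]; case: (rc) => vv [/XE[m dm _] _ _].
  move: dM rc br; rewrite dm u_le => mM /recE rc /brE br.
  have [k kn hk] := Ha m p q mM rc br; exists k => //; case: br => _ _ py yq _.
  exact: conv hk.
have ecoded k : (k < n.+1)%N -> exists2 z, coded c y (u M) K z & `|z - k.+1%:R| < delta * K.
  move=> kn; have [m [p [q [mM rc br hk]]]] := Hb k kn.
  have [_ _ py yq _] := br.
  have qp : q - p != 0 by rewrite subr_eq0 gt_eqF// (le_lt_trans py).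
  exists (K * (y - p) / (q - p)).
    exists (u m), p, q; split; rewrite ?u_le ?divfK//; [exact/recE|exact/brE].
  by apply: (conv k _ p q) => //; rewrite divfK.
have dKe : delta * K < eps.
  have : delta * K <= delta * K * K by rewrite ler_peMr// mulr_ge0// ltW.
  by rewrite dK; lra.
exists c, y, (u M), K; split=> //.
  by have [z zS hz] := ecoded n (ltnSn n); exists z => //; exact: lt_trans dKe.
move=> z zS; have [[|k] kn hk] := codedE z zS; [left|right].
  by rewrite -(ltr_pM2r K0) dK in hk; move: hk eps0; lra.
have [z' z'S hz'] := ecoded k (ltnW kn); exists z' => //.
have -> : z - z' - 1 = (z - k.+2%:R) - (z' - k.+1%:R) by rewrite -[k.+2%:R]natr1; ring.
apply: (@le_lt_trans _ _ ((`|z - k.+2%:R| + `|z' - k.+1%:R|) * K)).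
  by rewrite ler_pM2r// ler_normB.
rewrite -(ltr_pM2r K0) dK in hk; rewrite -(ltr_pM2r K0) dK in hz'.
by rewrite mulrDl; lra.
Qed.

End NaturalNumbersFromDenseSequence.

(** * Density of irrational rotations *)

Section IrrationalRotation.
Context {R : realType}.
Implicit Types theta u v : R.

Definition frac_part (y : R) : R := y - (Num.floor y)%:~R.

Lemma frac_part_itv y : 0 <= frac_part y < 1.
Proof.
have := floor_itv y; rewrite /frac_part subr_ge0 ltrBlDl => /andP[-> /=].
by rewrite intrD.
Qed.

Lemma frac_part_uniq y (k : int) : 0 <= y - k%:~R < 1 -> frac_part y = y - k%:~R.
Proof.
move=> /andP[h1 h2]; rewrite /frac_part (@floor_def _ y k)//.
by rewrite -subr_ge0 h1 intrD -ltrBlDl.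
Qed.

(** Pigeonhole: among [N.+1] fractional parts two fall into the same one of [N] intervals of length
    [N%:R^-1 < eps]. Irrationality makes their difference nonzero. *)
Lemma irrational_return theta eps : irrational theta -> 0 < eps ->
  exists n (l : int), 0 < `|n%:R * theta - l%:~R| < eps.
Proof.
move=> irr eps0; pose t n := frac_part (n%:R * theta).
pose N := (Num.bound eps^-1).+1.
have N0 : (0 : R) < N%:R by rewrite ltr0n.
have Neps : N%:R^-1 < eps.
  rewrite -[ltRHS]invrK ltf_pV2 ?posrE ?invr_gt0//.
  apply: (@lt_le_trans _ _ (Num.bound eps^-1)%:R); last by rewrite ler_nat.
  by apply: archi_boundP; rewrite invr_ge0 ltW.
have tN n : 0 <= N%:R * t n < N%:R.
  have /andP[h1 h2] := frac_part_itv (n%:R * theta).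
  by rewrite mulr_ge0 ?(ltW N0)//= -[ltRHS]mulr1 ltr_pM2l.
have bP n : (absz (Num.floor (N%:R * t n)%R) < N)%N.
  have /andP[h1 h2] := tN n; rewrite -ltz_nat gez0_abs ?floor_ge0//.
  by rewrite floor_lt_int.
pose bin (i : 'I_N.+1) : 'I_N := Ordinal (bP i).
have [i [j [ij bij]]] : exists i j : 'I_N.+1, (i < j)%N /\ bin i = bin j.
  apply: contrapT => no.
  have inj : injective bin.
    move=> i j bij; apply/val_inj/eqP; rewrite eqn_leq; apply/andP.
    by split; rewrite leqNgt; apply/negP => h; apply: no;
      [exists j, i|exists i, j].
  by have := leq_card bin inj; rewrite !card_ord ltnn.
have close : `|t j - t i| < eps.
  have e : Num.floor (N%:R * t i) = Num.floor (N%:R * t j).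
    have /(congr1 val)/= := bij; have /andP[hi _] := tN i; have /andP[hj _] := tN j.
    move=> /(congr1 Posz); rewrite !gez0_abs ?floor_ge0//.
  have /andP[a1 a2] := floor_itv (N%:R * t i).
  have /andP[b1 b2] := floor_itv (N%:R * t j); rewrite -e in b1 b2.
  rewrite intrD in a2 b2.
  apply: lt_trans Neps; rewrite -(ltr_pM2l N0) mulfV ?lt0r_neq0//.
  rewrite -{1}(gtr0_norm N0) -normrM mulrBr ltr_norml.
  by move: a1 a2 b1 b2; lra.
exists (j - i)%N, (Num.floor (j%:R * theta) - Num.floor (i%:R * theta)).
have e : (j - i)%:R * theta - (Num.floor (j%:R * theta) - Num.floor (i%:R * theta))%:~R
    = t j - t i.
  by rewrite natrB ?(ltnW ij)// /t /frac_part intrB; ring.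
apply/andP; split; last by rewrite e.
rewrite normr_gt0 subr_eq0; apply/eqP => h; apply: irr; apply/rationalP.
exists (Num.floor (j%:R * theta) - Num.floor (i%:R * theta)), (j - i)%N.
by rewrite -h mulrAC mulfV ?mul1r// pnatr_eq0 -lt0n subn_gt0.
Qed.

(** Multiples of a return shorter than [v - u] cannot jump over [(u, v)]; for a negative return they
    are counted down from 1. *)
Lemma irrational_rotation_dense theta u v : irrational theta ->
  0 <= u -> u < v -> v <= 1 -> exists m, u < frac_part (m%:R * theta) < v.
Proof.
move=> irr u0 uv v1; have vu0 : 0 < v - u by rewrite subr_gt0.
have [n [l /andP[d0 dvu]]] := irrational_return irr vu0.
set d := n%:R * theta - l%:~R in d0 dvu.
have step (x : R) e : 0 <= x -> 0 < e -> exists k : nat, x < k%:R * e <= x + e.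
  move=> x0 e0; have := floor_itv (x / e); have f0 : 0 <= Num.floor (x / e).
    by rewrite floor_ge0 divr_ge0// ltW.
  rewrite -(gez0_abs f0) => /andP[h1 h2]; exists (absz (Num.floor (x / e))).+1.
  rewrite ler_pdivlMr// in h1; rewrite ltr_pdivrMr// intrD in h2.
  by rewrite -natr1 h2/= mulrDl mul1r lerD2r.
have [dpos|dneg] := ltP 0 d.
  have [k /andP[k1 k2]] := step u d u0 dpos.
  rewrite gtr0_norm// in dvu.
  have kv : k%:R * d < v by apply: (le_lt_trans k2); rewrite -ltrBrDl.
  exists (k * n)%N.
  rewrite (@frac_part_uniq _ (k%:Z * l)) (_ : _ - _ = k%:R * d) ?k1 ?kv//;
    try by rewrite /d natrM intrM -pmulrn; ring.
  by rewrite (le_trans u0 (ltW k1))/= (lt_le_trans kv).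
have [|k /andP[k1 k2]] := step (1 - v) `|d| _ d0; first by rewrite subr_ge0.
have ku : k%:R * `|d| < 1 - u by apply: (le_lt_trans k2); lra.
rewrite ler0_norm// in k1 k2 ku.
have e : (k * n)%:R * theta - (k%:Z * l - 1)%:~R = 1 + k%:R * d.
  by rewrite /d natrM intrB intrM -pmulrn; ring.
exists (k * n)%N; rewrite (@frac_part_uniq _ (k%:Z * l - 1)) e; move: k1 ku; rewrite mulrN.
  by move=> k1 ku; apply/andP; split; lra.
by move=> k1 ku; apply/andP; split; lra.
Qed.

End IrrationalRotation.

(** * The integers from two multiplicative lattices *)

Section TwoLattices.
Context {R : realType} (L : set (primitive R)).

(* With A = alpha^Z and B = beta^Z: d is in alpha^N and v is its representative
   in [1, beta) modulo B. *)
Definition lattice_residue (A B : R -> Prop) (beta d v : R) :=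
  [/\ A d, 1 <= d, 1 <= v, v < beta & exists2 b, B b & d = v * b].

(** In logarithms to base [beta], [alpha ^+ m] becomes [m%:R * theta]; the factor [b] removes an
    integer, and [1 <= v < beta] makes the rest a fractional part. *)
Lemma lattice_residueP (alpha beta : R) : 1 < alpha -> 1 < beta ->
  let theta := ln alpha / ln beta in
  forall d v, lattice_residue (fun x => exists k : int, x = alpha ^ k)
      (fun x => exists k : int, x = beta ^ k) beta d v <->
    exists2 m, d = alpha ^+ m & v = expR (frac_part (m%:R * theta) * ln beta).
Proof.
move=> al be theta d v.
have al0 : 0 < alpha := lt_trans ltr01 al; have be0 : 0 < beta := lt_trans ltr01 be.
have lnb : 0 < ln beta by apply: ln_gt0.
have lnb0 := lt0r_neq0 lnb.
have pw (k : int) : expR (k%:~R * ln beta) = beta ^ k.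
  by rewrite -powR_intmul ?(ltW be0)// /powR gt_eqF.
have al_m m : alpha ^+ m = expR (m%:R * theta * ln beta).
  by rewrite /theta -mulrA divfK// expRM_natl lnK.
split=> [[[k dk] d1 v1 vb [b [l bl] dvb]]|[m -> ->]].
  have [m km] : exists m : nat, k = m.
    case: k dk => [m|m] dk; first by exists m.
    move: d1; rewrite dk NegzE -exprnN leNgt invf_lt1 ?exprn_gt0//.
    by rewrite exprn_egt1.
  exists m; first by rewrite dk km.
  have dm : d = alpha ^+ m by rewrite dk km.
  have v0 : 0 < v := lt_le_trans ltr01 v1.
  have vE : v = expR ((m%:R * theta - l%:~R) * ln beta).
    rewrite mulrBl expRB -al_m -dm pw dvb bl mulfK//.
    by rewrite expfz_neq0// lt0r_neq0.
  rewrite (@frac_part_uniq _ _ l)//.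
  move: v1 vb; rewrite vE [leLHS](esym (@expR0 R)) ler_expR pmulr_lge0// => -> /=.
  by rewrite -[X in _ < X](lnK be0) ltr_expR gtr_pMl.
have /andP[f0 f1] := frac_part_itv (m%:R * theta).
split; first by exists m%:Z.
- by rewrite exprn_ege1// ltW.
- by rewrite [leLHS](esym (@expR0 R)) ler_expR mulr_ge0// ltW.
- by rewrite -[ltRHS](lnK be0) ltr_expR gtr_pMl.
- exists (beta ^ Num.floor (m%:R * theta)); first by eexists.
  by rewrite -pw -expRD -mulrDl subrK -al_m.
Qed.

(** With codes [alpha ^+ m] and points their residues in [[1, beta)], dense by irrationality,
    [near_natural] singles out the positive integers and is first-order. *)
Lemma definable_int_of_lattices (alpha beta : R) :
  1 < alpha -> 1 < beta -> irrational (ln alpha / ln beta) ->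
  definable L (fun e => exists k : int, e 0%N = alpha ^ k) ->
  definable L (fun e => exists k : int, e 0%N = beta ^ k) ->
  definable L (fun e => exists k : int, e 0%N = k%:~R).
Proof.
move=> al be irr dA dB.
have al0 : 0 < alpha := lt_trans ltr01 al; have be0 : 0 < beta := lt_trans ltr01 be.
have lnb : 0 < ln beta by apply: ln_gt0.
pose A x := exists k : int, x = alpha ^ k; pose B x := exists k : int, x = beta ^ k.
pose X := lattice_residue A B beta.
have XP := lattice_residueP al be.
have nearP w : near_natural X w <-> exists n : nat, w = n.+1%:R.
  split; first exact: near_natural_nat.
  move=> [n ->].
  apply: (@nat_near_natural _ X (fun m => alpha ^+ m)
    (fun m => expR (frac_part (m%:R * (ln alpha / ln beta)) * ln beta)) 1 beta) => //.
  - by move=> m k; rewrite ltr_eXn2l.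
  - by rewrite mul0r /frac_part floor0 subrr mul0r expR0.
  - move=> c1 c2 h1 h12 h2; have c10 : 0 < c1 := lt_le_trans ltr01 h1.
    have c20 : 0 < c2 := lt_trans c10 h12.
    have [|||m hm] := @irrational_rotation_dense _ _ (ln c1 / ln beta) (ln c2 / ln beta) irr.
    + by rewrite divr_ge0 ?ln_ge0// ltW.
    + by rewrite ltr_pM2r ?invr_gt0// ltr_ln ?posrE.
    + by rewrite ler_pdivrMr// mul1r ler_ln ?posrE.
    exists m; move: hm; rewrite ltr_pdivrMr// ltr_pdivlMr// => /andP[k1 k2].
    apply/andP; split; first by rewrite -[ltLHS](lnK c10) ltr_expR.
    by rewrite -[ltRHS](lnK c20) ltr_expR.
have dX : definable L (fun e => X (e 0%N) (e 1%N)).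
  apply: (@definable_ext _ _ (fun e => A (e 0%N) /\ 1 <= e 0%N /\ 1 <= e 1%N /\
      e 1%N < beta /\ exists b, B b /\ e 0%N = e 1%N * b)).
    move=> e; split=> [[h1 [h2 [h3 [h4 [b [h5 h6]]]]]]|[h1 h2 h3 h4 [b h5 h6]]].
      by split=> //; exists b.
    by do 4 split=> //; exists b.
  by repeat definability; rewrite ?/A ?/B //; apply: (definable_rel1 dB); definability.
have drec : definable L (fun e => rec_at X (e 0%N) (e 1%N)).
  apply: (@definable_ext _ _ (fun e => exists v, X (e 1%N) v /\ v < e 0%N /\
    forall d' v', X d' v' -> d' < e 1%N -> ~ (v <= v' /\ v' < e 0%N))).
    by move=> e; split=> [[v [? [? ?]]]|[v [? ? ?]]]; exists v.
  by repeat definability; apply: (definable_rel2 dX); definability.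
have dbr : definable L (fun e => bracket_at X (e 0%N) (e 1%N) (e 2%N) (e 3%N)).
  apply: (@definable_ext _ _ (fun e => (exists d', X d' (e 2%N) /\ d' <= e 0%N) /\
    (exists d', X d' (e 3%N) /\ d' <= e 0%N) /\ e 2%N <= e 1%N /\ e 1%N < e 3%N /\
    forall d' v, X d' v -> d' <= e 0%N -> ~ (e 2%N < v /\ v < e 3%N))).
    move=> e; split=> [[[d1 [? ?]] [[d2 [? ?]] [? [? ?]]]]|[[d1 ? ?] [d2 ? ?] ? ? ?]].
      by split=> //; [exists d1|exists d2].
    by split; [exists d1|split; [exists d2|]].
  by repeat definability; apply: (definable_rel2 dX); definability.
have dcoded (r : nat -> nat) : definable L
    (fun e => coded X (e (r 0%N)) (e (r 1%N)) (e (r 2%N)) (e (r 3%N)) (e (r 4%N))).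
  apply: (@definable_rename _ _ (fun e => coded X (e 0%N) (e 1%N) (e 2%N) (e 3%N) (e 4%N))).
  apply: (@definable_ext _ _ (fun e => exists d p q, d <= e 2%N /\ rec_at X (e 0%N) d /\
    bracket_at X d (e 1%N) p q /\ e 4%N * (q - p) = e 3%N * (e 1%N - p))).
    by move=> e; split=> [[d [p [q [? [? [? ?]]]]]]|[d [p [q [? ? ? ?]]]]]; exists d, p, q.
  repeat definability; first by apply: (definable_rel2 drec); definability.
  exact: (definable_rename (fun i => match i with 0 => 2 | 1 => 4 | 2 => 1 | _ => 0 end)%N dbr).
have dnear : definable L (fun e => near_natural X (e 0%N)).
  apply: (@definable_ext _ _ (fun e => forall eps, 0 < eps -> exists c y b K,
    1 <= K /\ (exists z, coded X c y b K z /\ `|z - e 0%N| < eps) /\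
    forall z, coded X c y b K z -> `|z - 1| * K < eps \/
      exists z', coded X c y b K z' /\ `|z - z' - 1| * K < eps)).
    move=> e; split=> H eps eps0; have [c [y [b [K]]]] := H eps eps0.
      move=> [K1 [[z [zS hz]] HS]]; exists c, y, b, K; split=> //; first by exists z.
      by move=> z' /HS[|[z'' [? ?]]]; [left|right; exists z''].
    move=> [K1 [z zS hz] HS]; exists c, y, b, K; split=> //; split; first by exists z.
    by move=> z' /HS[|[z'' ? ?]]; [left|right; exists z''].
  repeat definability.
  (* Innermost first, the bound variables are [z], [K], [b], [y], [c]; in the third goal [z']
     precedes them all. *)
  - exact: (dcoded (fun i => match i with 0 => 4 | 1 => 3 | 2 => 2 | 3 => 1 | _ => 0 end)%N).
  - exact: (dcoded (fun i => match i with 0 => 4 | 1 => 3 | 2 => 2 | 3 => 1 | _ => 0 end)%N).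
  - exact: (dcoded (fun i => match i with 0 => 5 | 1 => 4 | 2 => 3 | 3 => 2 | _ => 0 end)%N).
apply: (@definable_ext _ _ (fun e =>
  near_natural X (e 0%N) \/ e 0%N = 0 \/ near_natural X (- e 0%N))).
  move=> e; rewrite !nearP; split.
    move=> [[n ->]|[->|[n h]]]; first by exists n.+1.
      by exists 0.
    by exists (- n.+1%:Z); rewrite -[LHS]opprK h intrN.
  move=> [[[|n]|n] ->]; [by right; left|by left; exists n|].
  by right; right; exists n; rewrite NegzE intrN opprK.
repeat definability; first exact: dnear.
by apply: (definable_rel1 dnear); repeat definability.
Qed.

End TwoLattices.

(** * Definability of s^Z and of Z from a single function *)

Section Definability_of_lattice.
Context {R : realType} (L : set (primitive R)) (s c : R) (s_gt1 : 1 < s).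

Let s_gt0 : 0 < s. Proof. exact: lt_trans s_gt1. Qed.

(** The formula transcribes [xlogder_period]. As [Q] is known to be the graph only beyond [c] and 0,
    it is used for large [x], where it determines [y] and [y']. *)
Lemma definable_lattice (Q : R -> R -> Prop) :
  definable L (fun e => Q (e 0%N) (e 1%N)) ->
  (forall x y, c < x -> 0 < x -> Q x y <-> y = xlogder_F' s x) ->
  definable L (fun e => exists k : int, e 0%N = s ^ k).
Proof.
move=> dQ QP.
apply: (@definable_ext _ _ (fun e => 0 < e 0%N /\ forall eps, 0 < eps ->
  exists M, forall x, M < x -> forall y, Q x y -> forall y', Q (e 0%N * x) y' ->
    `|e 0%N * x * y' - x * y| < eps)); last first.
  by repeat definability; apply: (definable_rel2 dQ); repeat definability.
move=> e; split=> [[t0 h]|[k tk]].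
  apply/(xlogder_period s_gt1 t0) => eps eps0; have [M hM] := h eps eps0.
  exists (Num.max M (Num.max 0 (Num.max c (c / e 0%N)))) => x.
  rewrite !gt_max => /and4P[Mx x0 cx ctx]; rewrite subr0; apply: hM => //.
    exact/QP.
  apply/QP; rewrite ?mulr_gt0// mulrC -ltr_pdivrMr//.
have t0 : 0 < e 0%N by rewrite tk exprz_gt0.
split=> // eps eps0.
have [M hM] := (xlogder_period s_gt1 t0).2 (ex_intro _ k tk) eps eps0.
exists (Num.max M (Num.max 0 (Num.max c (c / e 0%N)))) => x.
rewrite !gt_max => /and4P[Mx x0 cx ctx] y /QP -> // y' /QP -> //.
- by have := hM x Mx; rewrite subr0.
- by rewrite mulrC -ltr_pdivrMr.
- by rewrite mulr_gt0.
Qed.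

Lemma definable_off_zeros (f : R -> R) :
  L (prim (line_graph_on (off_zeros s c) f)) ->
  exists2 Q : R -> R -> Prop, definable L (fun e => Q (e 0%N) (e 1%N)) &
    forall x y, c < x -> 0 < x -> Q x y <-> y = f x.
Proof.
move=> /definable_line_graph d; exists (fun x y => off_zeros s c x /\ y = f x) => //.
move=> x y cx x0; split=> [[]//|->]; split=> //; split=> //.
exact: F_gt_neq0.
Qed.

Lemma definable_lattice_xlogder :
  L (prim (line_graph_on (off_zeros s c) (xlogder_F' s))) ->
  definable L (fun e => exists k : int, e 0%N = s ^ k).
Proof. by move=> /definable_off_zeros[Q dQ QP]; exact: definable_lattice dQ QP. Qed.

(** The form in which a derivative can be written as a first-order formula. *)
Lemma is_deriveP (f : R -> R) x d :
  is_derive x (1 : R) f d <-> forall eps, 0 < eps -> exists delta, 0 < delta /\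
    forall h, 0 < `|h| -> `|h| < delta -> `|(f (x + h) - f x) / h - d| < eps.
Proof.
have cv : is_derive x (1 : R) f d <->
    (h^-1 *: (f (h + x) - f x) @[h --> 0^'] --> d).
  have e : (fun h : R => h^-1 *: (f (h%:A + x) - f x)) =
           (fun h : R => h^-1 *: (f (h + x) - f x)).
    by apply/funext => h; rewrite [h%:A]mulr1.
  split=> [[df <-]|h].
    by move: df; rewrite /derivable/= e => /cvg_ex[l hl]; rewrite /derive/= e (cvg_lim _ hl).
  have df : derivable f x 1 by rewrite /derivable/= e; apply/cvg_ex; exists d.
  by apply: DeriveDef => //; rewrite /derive/= e; apply: cvg_lim.
rewrite cv; split=> [/cvgrPdist_lt H eps /H|H].
  rewrite near_withinE => -[delta /= d0 hd]; exists delta; split=> // h h0 hdl.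
  rewrite distrC; have := hd h; rewrite /= sub0r normrN => /(_ hdl).
  by rewrite -normr_gt0 => /(_ h0); rewrite [_ *: _]mulrC [h + x]addrC.
apply/cvgrPdist_lt => eps /H[delta [d0 hd]]; rewrite near_withinE; exists delta => //= h.
rewrite /ball_/= sub0r normrN => hdl h0; rewrite distrC [_ *: _]mulrC [h + x]addrC.
by apply: hd; rewrite ?normr_gt0.
Qed.

(** By [logder_scale] each factor [s] adds [y / (1 + y) = 1 - (1 + y)^-1], where [y] tends to
    infinity with [x]. *)
Lemma logder_shift k : tends_pinfty
  (fun x => s ^+ k * x * logder_F s (s ^+ k * x) - x * logder_F s x) k%:R.
Proof.
elim: k => [|k IH] e e0.
  by exists 0 => x _; rewrite expr0 mul1r subrr subr0 normr0.
have e2 : 0 < e / 2 by rewrite divr_gt0.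
have [M hM] := IH _ e2; exists (Num.max M (Num.max 0 (2 / e))) => x.
rewrite !gt_max => /and3P[Mx x0 ex].
have y0 : 0 < s ^+ k * x by rewrite mulr_gt0// exprn_gt0.
have sy0 : 0 < s * (s ^+ k * x) by rewrite mulr_gt0.
rewrite exprS -[s * _ * x]mulrA (logder_scale s_gt1 (F_gt_neq0 s_gt1 sy0)).
rewrite -natr1; set y := s ^+ k * x in y0 sy0 *.
have y1 : 0 < 1 + y by rewrite addr_gt0.
rewrite (_ : _ - _ = (y * logder_F s y - x * logder_F s x - k%:R) - (1 + y)^-1);
  last by field; rewrite lt0r_neq0.
rewrite (le_lt_trans (ler_normB _ _))// [e]splitr ltrD ?hM//.
rewrite gtr0_norm ?invr_gt0// -[ltRHS]invrK ltf_pV2 ?posrE ?invr_gt0// invf_div.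
apply: (lt_le_trans ex); rewrite (@le_trans _ _ y)//; last by rewrite lerDr.
by rewrite ler_peMl ?(ltW x0)// exprn_ege1// ltW.
Qed.

Lemma tends_pinfty_uniq (f : R -> R) l l' :
  tends_pinfty f l -> tends_pinfty f l' -> l = l'.
Proof.
move=> h h'; apply/eqP; rewrite -subr_eq0 -normr_le0; apply/ler_addgt0Pr => e e0.
rewrite add0r; have e2 : 0 < e / 2 by rewrite divr_gt0.
have [M hM] := h _ e2; have [M' hM'] := h' _ e2.
have [M1 M2] : M < Num.max M M' + 1 /\ M' < Num.max M M' + 1.
  by split; rewrite ltr_pwDr// le_max lexx ?orbT.
have := hM _ M1; have := hM' _ M2; set y := f _ => k1 k2.
rewrite (_ : l - l' = (y - l') - (y - l)); last by ring.
by rewrite (le_trans (ler_normB _ _))// [e]splitr lerD// ltW.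
Qed.

Lemma logder_shiftz (k : int) : tends_pinfty
  (fun x => s ^ k * x * logder_F s (s ^ k * x) - x * logder_F s x) k%:~R.
Proof.
case: k => k; first exact: logder_shift.
(* A negative exponent is the positive case evaluated at [s ^- k.+1 * x], with the sign reversed. *)
move=> e e0; have [M hM] := @logder_shift k.+1 e e0.
exists (s ^+ k.+1 * M) => x Mx; rewrite NegzE -exprnN.
have Mx' : M < s ^- k.+1 * x by rewrite ltr_pdivlMl// exprn_gt0.
have := hM _ Mx'; rewrite [s ^+ k.+1 * _]mulrA mulfV ?mul1r; last first.
  by rewrite expf_neq0// lt0r_neq0.
rewrite -normrN; congr (`|_| < _); rewrite intrN -pmulrn; ring.
Qed.

Lemma definable_int_logder :
  L (prim (line_graph_on (off_zeros s c) (logder_F s))) ->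
  definable L (fun e => exists k : int, e 0%N = k%:~R).
Proof.
move=> /definable_off_zeros[P dP PP].
pose Q x y := c < x /\ 0 < x /\ forall eps, 0 < eps -> exists delta, 0 < delta /\
  forall h, 0 < `|h| -> `|h| < delta -> forall z, P x z -> forall z', P (x + h) z' ->
    `|((x + h) * z' - x * z) / h - y| < eps.
have dQ : definable L (fun e => Q (e 0%N) (e 1%N)).
  by rewrite /Q; repeat definability; apply: (definable_rel2 dP); repeat definability.
have QP x y : c < x -> 0 < x -> Q x y <-> y = xlogder_F' s x.
  (* Increments smaller than [m] keep [x + h] beyond [c] and 0, where [P] is the graph. *)
  move=> cx x0; pose m := Num.min x (x - c).
  have m0 : 0 < m by rewrite lt_min x0 subr_gt0.
  have hm h : `|h| < m -> c < x + h /\ 0 < x + h.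
    rewrite lt_min !ltr_norml => /andP[/andP[h1 _] /andP[h2 _]]; split; lra.
  have Fx := F_gt_neq0 s_gt1 x0.
  have QE : Q x y <-> is_derive x (1 : R) (fun x => x * logder_F s x) y.
    rewrite is_deriveP; split=> [[_ [_ H]]|H].
      move=> eps /H[delta [d0 hd]]; exists (Num.min delta m).
      split=> [|h h0]; first by rewrite lt_min d0.
      rewrite lt_min => /andP[hdl /hm[ch xh]]; apply: hd => //; exact/PP.
    do 2 split=> //; move=> eps /H[delta [d0 hd]]; exists (Num.min delta m).
    split=> [|h h0]; first by rewrite lt_min d0.
    rewrite lt_min => /andP[hdl /hm[ch xh]] z /PP -> // z' /PP -> //.
    exact: hd.
  rewrite QE; split=> [[_ <-]|->]; last exact: is_derive_xlogder.
  by have [_ <-] := is_derive_xlogder s_gt1 Fx.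
have dA := definable_lattice dQ QP.
apply: (@definable_ext _ _ (fun e => exists t, (exists k : int, t = s ^ k) /\
  forall eps, 0 < eps -> exists M, forall x, M < x -> forall z, P x z ->
    forall z', P (t * x) z' -> `|t * x * z' - x * z - e 0%N| < eps)); last first.
  repeat definability; try by apply: (definable_rel2 dP); repeat definability.
  exact: dA.
move=> e; split=> [[t [[k tk] H]]|[k ek]].
  exists k; have t0 : 0 < t by rewrite tk exprz_gt0.
  apply: tends_pinfty_uniq (logder_shiftz k) => eps eps0; have [M hM] := H eps eps0.
  exists (Num.max M (Num.max 0 (Num.max c (c / t)))) => x.
  rewrite !gt_max -tk => /and4P[Mx x0 cx ctx]; apply: hM => //; first exact/PP.
  by apply/PP; rewrite ?mulr_gt0// mulrC -ltr_pdivrMr.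
have t0 : 0 < s ^ k by rewrite exprz_gt0.
exists (s ^ k); split; first by exists k.
move=> eps eps0; have [M hM] := logder_shiftz k eps0.
exists (Num.max M (Num.max 0 (Num.max c (c / s ^ k)))) => x.
rewrite !gt_max => /and4P[Mx x0 cx ctx] z /PP -> // z' /PP -> //.
- by rewrite ek; exact: hM.
- by rewrite mulrC -ltr_pdivrMr.
- by rewrite mulr_gt0.
Qed.

End Definability_of_lattice.

(** * Power series of sums of double poles *)

Section Analyticity.
Context {R : realType}.
Implicit Types (w s : nat -> R) (h q v : R).

Lemma sum_derived_geometric v K :
  (1 - v) ^+ 2 * \sum_(0 <= k < K) k.+1%:R * v ^+ k =
  1 - K.+1%:R * v ^+ K + K%:R * v ^+ K.+1.
Proof.
elim: K => [|K IH]; first by rewrite big_geq// mulr0 expr0 mul0r addr0 mulr1 subrr.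
rewrite big_nat_recr//= mulrDr IH !exprS -[K.+2%:R]natr1 -[K.+1%:R]natr1.
by move: (v ^+ K) (K%:R) => V k; ring.
Qed.

Lemma derived_geometric_remainder v q K : `|v| <= q -> q < 1 ->
  `|(1 - v) ^- 2 - \sum_(0 <= k < K) k.+1%:R * v ^+ k| <=
  2 * (1 - q) ^- 2 * (K.+1%:R * q ^+ K).
Proof.
move=> vq q1; have q0 : 0 <= q := le_trans (normr_ge0 _) vq.
have hq : 0 < 1 - q by rewrite subr_gt0.
have hv : 0 < 1 - v.
  by rewrite subr_gt0 (le_lt_trans (ler_norm v))// (le_lt_trans vq).
have -> : (1 - v) ^- 2 - \sum_(0 <= k < K) k.+1%:R * v ^+ k =
    (1 - v) ^- 2 * (K.+1%:R * v ^+ K - K%:R * v ^+ K.+1).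
  apply: (mulfI (_ : (1 - v) ^+ 2 != 0)); first by rewrite expf_neq0// lt0r_neq0.
  rewrite mulrBr sum_derived_geometric mulrA mulfV ?mul1r; first by ring.
  by rewrite expf_neq0// lt0r_neq0.
rewrite normrM [leRHS](_ : _ = (1 - q) ^- 2 * (2 * (K.+1%:R * q ^+ K))); last by ring.
apply: ler_pM => //.
  rewrite normfV lef_pV2 ?posrE ?normr_gt0 ?expf_neq0 ?lt0r_neq0 ?exprn_gt0//.
  rewrite normrX lerXn2r ?nnegrE ?(ltW hq)// (gtr0_norm hv) lerD2l lerN2.
  exact: le_trans (ler_norm v) vq.
rewrite (le_trans (ler_normB _ _))// !normrM !normr_nat !normrX.
rewrite [leRHS](_ : _ = K.+1%:R * q ^+ K + K.+1%:R * q ^+ K); last by ring.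
apply: lerD; first by rewrite ler_wpM2l// lerXn2r ?nnegrE.
apply: ler_pM => //; first by rewrite ler_nat.
apply: (@le_trans _ _ (q ^+ K.+1)); first by rewrite lerXn2r ?nnegrE.
by rewrite exprS ler_piMl ?exprn_ge0// ltW.
Qed.

Lemma is_cvg_derived_geometric q : 0 <= q < 1 ->
  cvgn (series (fun k => k.+1%:R * q ^+ k)).
Proof.
move=> /andP[q0 q1]; have hq : 0 < (1 - q) ^+ 2 by rewrite exprn_gt0// subr_gt0.
apply: nondecreasing_is_cvgn.
  by apply: nondecreasing_series => n _ _; rewrite mulr_ge0// exprn_ge0.
exists ((1 - q) ^- 2) => _ [K _ <-]; rewrite -(ler_pM2l hq) mulfV ?lt0r_neq0//.
rewrite /series/= sum_derived_geometric -addrA gerDl addrC subr_le0.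
by apply: ler_pM; rewrite ?exprn_ge0// ?ler_nat// exprS ler_piMl ?exprn_ge0// ltW.
Qed.

Section PoleSeries.
Variables (w s : nat -> R) (S : R).
Hypotheses (w_ge0 : forall n, 0 <= w n) (w_cvg : cvgn (series w))
  (s_le : forall n, `|s n| <= S).

Let S_ge0 : 0 <= S. Proof. exact: le_trans (normr_ge0 _) (s_le 0). Qed.
Let W : R := limn (series w).
Let M k : R := limn (series (fun n => w n * s n ^+ k)).

(** Taylor coefficients at [h = 0] of the sum over [n] of [w n / (1 + h * s n) ^+ 2], from the
    expansion of [(1 + v) ^- 2]; [M k] is the [k]-th moment. *)
Definition pole_coef k : R := (- 1) ^+ k * k.+1%:R * M k.

Let term_le k n : `|w n * s n ^+ k| <= S ^+ k * w n.
Proof.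
by rewrite normrM normrX (ger0_norm (w_ge0 n)) mulrC ler_wpM2r// lerXn2r ?nnegrE.
Qed.

Let Sw_cvg k : cvgn (series (fun n => S ^+ k * w n)).
Proof. exact: is_cvg_seriesZ. Qed.

Let norm_term_cvg k : cvgn (series (fun n => `|w n * s n ^+ k|)).
Proof.
apply: (series_le_cvg _ _ (term_le k)) => // n.
by rewrite mulr_ge0// exprn_ge0.
Qed.

Let M_cvg k : series (fun n => w n * s n ^+ k) @ \oo --> M k.
Proof.
suff : cvgn (series (fun n => w n * s n ^+ k)) by [].
by apply: normed_cvg; exact: norm_term_cvg.
Qed.

Let M_le k : `|M k| <= S ^+ k * W.
Proof.
have h := @lim_series_norm _ _ (fun n => w n * s n ^+ k) (@norm_term_cvg k).
apply: (le_trans h).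
have <- : limn (series (fun n => S ^+ k * w n)) = S ^+ k * W.
  exact: lim_seriesZ.
exact: (lim_series_le (@norm_term_cvg k) (@Sw_cvg k) (term_le k)).
Qed.

Lemma is_cvg_pole_coef h : `|h| * S < 1 ->
  cvgn (series (fun k => `|pole_coef k| * `|h| ^+ k)).
Proof.
move=> hS; have W0 : 0 <= W.
  by apply: limr_ge => //; near=> i; exact: sumr_ge0.
apply: (@series_le_cvg _ _ (fun k => W * (k.+1%:R * (`|h| * S) ^+ k))).
- by move=> n; rewrite mulr_ge0// exprn_ge0.
- by move=> n; rewrite !mulr_ge0// exprn_ge0// mulr_ge0.
- move=> k; rewrite /pole_coef !normrM normrX normrN1 expr1n mul1r normr_nat exprMn.
  rewrite [leRHS](_ : _ = k.+1%:R * (S ^+ k * W) * `|h| ^+ k).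
    by rewrite ler_wpM2r ?exprn_ge0// ler_wpM2l.
  by ring.
- have h1 : 0 <= `|h| * S < 1 by rewrite hS mulr_ge0.
  exact: is_cvg_seriesZ (is_cvg_derived_geometric h1).
Unshelve. all: by end_near. Qed.

(** For a partial sum over [k < K] the limit over [n] can be taken inside; the remainder is at most
    [r K] for every [n], hence at most [W * r K] after summation. *)
Lemma cvg_pole_series h (l : R) : `|h| * S < 1 ->
  series (fun n => w n / (1 + h * s n) ^+ 2) @ \oo --> l ->
  series (fun k => pole_coef k * h ^+ k) @ \oo --> l.
Proof.
move=> hS fl; set q := `|h| * S in hS; have q0 : 0 <= q by rewrite mulr_ge0.
pose r K := 2 * (1 - q) ^- 2 * (K.+1%:R * q ^+ K).
have W0 : 0 <= W.
  by apply: limr_ge => //; near=> i; exact: sumr_ge0.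
have bound K : `|l - series (fun k => pole_coef k * h ^+ k) K| <= W * r K.
  have c1 : (fun N => series (fun n => w n / (1 + h * s n) ^+ 2) N -
      \sum_(0 <= k < K) ((- h) ^+ k * k.+1%:R *
      series (fun n => w n * s n ^+ k) N)) @ \oo --> l -
      series (fun k => pole_coef k * h ^+ k) K.
    apply: cvgB => //; rewrite /series/=.
    rewrite [X in _ --> X](_ : _ = \sum_(0 <= k < K) ((- h) ^+ k * k.+1%:R * M k)).
      elim: K => [|K IH].
        by under eq_fun do rewrite big_geq//; rewrite big_geq//; exact: cvg_cst.
      under eq_fun do rewrite big_nat_recr//=; rewrite big_nat_recr//=.
      apply: cvgD => //; apply: cvgM; [exact: cvg_cst|exact: M_cvg].
    apply: eq_bigr => k _; rewrite /pole_coef [(- h) ^+ k]exprNn; ring.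
  have /cvg_norm c2 := c1.
  rewrite -(cvg_lim _ c2)//; apply: limr_le; first by apply/cvg_ex; eexists; exact: c2.
  near=> N; rewrite /series/=.
  have -> : \sum_(0 <= k < K) (- h) ^+ k * k.+1%:R * (\sum_(0 <= n < N) w n * s n ^+ k)
      = \sum_(0 <= n < N) w n * \sum_(0 <= k < K) k.+1%:R * (- (h * s n)) ^+ k.
    under eq_bigr do rewrite mulr_sumr; rewrite exchange_big/=.
    apply: eq_bigr => n _; rewrite mulr_sumr; apply: eq_bigr => k _.
    by rewrite -mulNr exprMn; ring.
  rewrite -sumrB (le_trans (ler_norm_sum _ _ _))//.
  apply: (@le_trans _ _ (series w N * r K)).
    rewrite /series/= mulr_suml; apply: ler_sum => n _.
    rewrite -mulrBr normrM (ger0_norm (w_ge0 n)) ler_wpM2l//.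
    have := @derived_geometric_remainder (- (h * s n)) q K _ hS.
    rewrite opprK; apply.
    by rewrite normrN normrM ler_wpM2l.
  rewrite ler_wpM2r ?mulr_ge0 ?invr_ge0 ?exprn_ge0 ?subr_ge0 ?(ltW hS)//.
  apply: nondecreasing_cvgn_le => //.
  by apply: nondecreasing_series => n _ _.
have r0 : W * r K @[K --> \oo] --> 0.
  rewrite -[X in _ --> X](mulr0 (W)); apply: cvgM; first exact: cvg_cst.
  rewrite -[X in _ --> X](mulr0 (2 * (1 - q) ^- 2)); apply: cvgM; first exact: cvg_cst.
  by apply: cvg_series_cvg_0; apply: is_cvg_derived_geometric; rewrite q0.
apply/cvgrPdist_le => e e0.
move/cvgrPdist_le : r0 => /(_ _ e0); apply: filterS => K hK.
apply: (le_trans (bound K)); apply: le_trans hK.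
by rewrite sub0r normrN ler_norm.
Unshelve. all: by end_near. Qed.

End PoleSeries.

Lemma power_series_sum1 (c : nat -> R) (y : 'rV[R]_1) :
  power_series_sum (fun k => c (k 0)) y = series (fun k => c k * y 0 0 ^+ k).
Proof.
apply/funext => N; rewrite /power_series_sum /series/= big_mkord.
rewrite (reindex (fun j : 'I_N => [ffun _ : 'I_1 => j])) /=.
  by apply: eq_bigr => j _; rewrite big_ord1 !ffunE.
exists (fun f : {ffun 'I_1 -> 'I_N} => f 0) => [j _|f _]; first by rewrite ffunE.
by apply/ffunP => i; rewrite ffunE ord1.
Qed.

Lemma real_analytic_at_line (g : R -> R) (a : 'rV[R]_1) (c : nat -> R) d : 0 < d ->
  (forall h, `|h| < d -> cvgn (series (fun k => `|c k| * `|h| ^+ k)) /\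
    series (fun k => c k * h ^+ k) @ \oo --> g (a 0 0 + h)) ->
  real_analytic_at (fun x => g (x 0 0)) a.
Proof.
move=> d0 H; exists (fun k => c (k 0)), d; split=> // x /(_ 0) /H[h1 h2].
rewrite (power_series_sum1 (fun k => `|c k|)) power_series_sum1 !mxE; split=> //.
by move: h2; rewrite [a 0 0 + _]addrC subrK.
Qed.

End Analyticity.

(** * Definability over restricted analytic functions *)

Section RestrictedAnalytic.
Context {R : realType} (a : R) (a_gt1 : 1 < a).

Let a_gt0 : 0 < a. Proof. exact: lt_trans a_gt1. Qed.
Let D := xlogder_F' a.

(* u |-> 2 u - 1 carries the unit interval to [-1, 1]. *)
Let g (u : R) : R := D (2 * u - 1).
Let U : set 'rV[R]_1 := [set x | - a < 2 * x 0 0 - 1].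

(** A displacement [h] of the argument of [g] moves [y] by [2 * h], which gives the terms the form
    [w n / (1 + h * s n) ^+ 2]. The radius is half the distance from [y] to the nearest pole
    [- a]. *)
Lemma xlogder_analytic (x : 'rV[R]_1) : U x -> real_analytic_at (fun x => g (x 0 0)) x.
Proof.
rewrite /U/=; set y := 2 * x 0 0 - 1 => ay.
have ay0 : 0 < a + y by rewrite addrC -(opprK a) subr_gt0.
have an n : a + y <= a ^+ n.+1 + y.
  by rewrite lerD2r exprS ler_peMr ?(ltW a_gt0)// exprn_ege1// ltW.
have pos n : 0 < a ^+ n.+1 + y := lt_le_trans ay0 (an n).
pose w n := a ^+ n.+1 / (a ^+ n.+1 + y) ^+ 2; pose s n := 2 / (a ^+ n.+1 + y).
have w0 n : 0 <= w n by rewrite divr_ge0 ?exprn_ge0// ltW.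
have wc : cvgn (series w).
  by apply/cvg_ex; exists (D y); exact: (cvg_xlogder a_gt1 (F_neq0 a_gt1 ay)).
have sS n : `|s n| <= 2 / (a + y).
  rewrite ger0_norm ?divr_ge0 ?(ltW (pos n))// ler_pM2l//.
  by rewrite lef_pV2 ?posrE.
apply: (@real_analytic_at_line _ g x (pole_coef w s) ((a + y) / 2)).
  by rewrite divr_gt0.
move=> h hd; have hS : `|h| * (2 / (a + y)) < 1.
  by rewrite mulrA ltr_pdivrMr// mul1r -ltr_pdivlMr.
split; first exact: is_cvg_pole_coef hS.
apply: (cvg_pole_series w0 wc sS hS).
have hy : - a < y + 2 * h.
  have : - (2 * h) < a + y; last by lra.
  apply: le_lt_trans (ler_norm _) _; rewrite normrN normrM ger0_norm//.
  by rewrite mulrC -ltr_pdivlMr.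
have -> : g (x 0 0 + h) = D (y + 2 * h) by congr D; rewrite /y; ring.
rewrite (_ : (fun n => _) = (fun n => a ^+ n.+1 / (a ^+ n.+1 + (y + 2 * h)) ^+ 2)).
  exact: (cvg_xlogder a_gt1 (F_neq0 a_gt1 hy)).
apply/funext => n; rewrite /w /s.
have p1 : 0 < a ^+ n.+1 + (y + 2 * h).
  rewrite (lt_le_trans (_ : 0 < a + (y + 2 * h)))//; first by lra.
  by rewrite lerD2r exprS ler_peMr ?(ltW a_gt0)// exprn_ege1// ltW.
have p2 := pos n; move: (a ^+ n.+1) p1 p2 => A p1 p2.
field; rewrite (lt0r_neq0 p2)/=.
by rewrite lt0r_neq0//; lra.
Qed.

Lemma R_an_xlogder (L : set (primitive R)) : @R_an R `<=` L ->
  exists2 k : R -> R, definable L (fun e => e 1%N = k (e 0%N)) &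
    forall u, 0 <= u <= 1 -> k u = D (2 * u - 1).
Proof.
move=> RL; pose f (x : 'rV[R]_1) := g (x 0 0).
pose k (u : R) := patch (fun=> 0) (@unit_cube R 1) f (const_mx u).
have Lk : L (prim (line_graph_on setT k)).
  apply: RL; exists 1%N, U, f; split; first by [].
  - rewrite (_ : U = (fun x : 'rV[R]_1 => x 0 0) @^-1` [set u | - a < 2 * u - 1])//.
    apply: open_comp; first by move=> x _; exact: coord_continuous.
    rewrite (_ : [set u | _] = [set u | (1 - a) / 2 < u]); first exact: open_gt.
    by apply/seteqP; split=> u /=; rewrite ltr_pdivrMr//; lra.
  - move=> x /(_ 0) /andP[x0 _]; rewrite /U/=.
    by move: a_gt1; lra.
  - by move=> x; exact: xlogder_analytic.
  - rewrite /line_graph_on (_ : line_set setT = setT); last by apply/seteqP; split.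
    congr (prim (graph_on _ _)); apply/funext => x; rewrite /k; congr (patch _ _ _ _).
    by apply/rowP => i; rewrite mxE ord1.
exists k; first by apply: definable_ext (definable_line_graph Lk) => e; split=> [[]|].
move=> u u01; rewrite /k /patch ifT ?/f ?mxE//.
by rewrite inE => i; rewrite mxE.
Qed.

Lemma definable_xlogder (L : set (primitive R)) (c : R) : @R_an R `<=` L ->
  definable L (fun e => exists k : int, e 0%N = a ^ k) ->
  definable L (fun e => off_zeros a c (e 0%N) /\ e 1%N = D (e 0%N)).
Proof.
move=> RL dA; have [k dk kD] := R_an_xlogder RL.
pose near0 N x y := `|x| <= a ^+ N /\ F a x != 0 /\ y = D x.
have dnear N : definable L (fun e => near0 N (e 0%N) (e 1%N)).
  elim: N => [|N IH].
    (* [F a] has no zero in [[-1, 1]], so the formula there needs no clause on zeros. *)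
    apply: (@definable_ext _ _ (fun e => `|e 0%N| <= 1 /\
      e 1%N = k ((e 0%N + 1) / 2))); last first.
      apply: definable_and; first by repeat definability.
      by apply: (@definable_rel2 _ _ (fun x y => y = k x) _ _ dk); repeat definability.
    move=> e; have kE : `|e 0%N| <= 1 -> k ((e 0%N + 1) / 2) = D (e 0%N).
      rewrite ler_norml => /andP[h1 h2]; rewrite kD; last by apply/andP; split; lra.
      by congr D; field.
    split=> [[h ->]|[h [_ ->]]]; last by rewrite kE.
    split=> //; split; last exact: kE.
    apply: (F_neq0 a_gt1); move: h a_gt1; rewrite ler_norml => /andP[h _]; lra.
  (* [xlogder_scale] at [e 0%N / a] passes from radius [a ^+ N] to [a ^+ N.+1]; the new clause
     excludes the zero [- a]. *)
  apply: (@definable_ext _ _ (fun e => `|e 0%N| <= a ^+ N.+1 /\ ~ (1 + e 0%N / a = 0) /\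
      exists y, near0 N (e 0%N / a) y /\ a * e 1%N = (1 + e 0%N / a) ^- 2 + y)).
    move=> e; have a0 := lt0r_neq0 a_gt0.
    have e0E : e 0%N = a * (e 0%N / a) by rewrite mulrC divfK.
    have FE : (F a (e 0%N) != 0) = (1 + e 0%N / a != 0) && (F a (e 0%N / a) != 0).
      by rewrite {1}e0E F_scale// mulf_eq0 negb_or.
    have nE : (`|e 0%N / a| <= a ^+ N) = (`|e 0%N| <= a ^+ N.+1).
      by rewrite normrM normfV (gtr0_norm a_gt0) ler_pdivrMr// -exprSr.
    have DE : F a (e 0%N) != 0 -> a * D (e 0%N) = (1 + e 0%N / a) ^- 2 + D (e 0%N / a).
      by move=> Fe; rewrite {1}e0E /D xlogder_scale// -e0E.
    split=> [[h [/eqP h1 [y [[_ [F1 ->]] yE]]]]|[h [Fe yE]]].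
      have Fe : F a (e 0%N) != 0 by rewrite FE h1.
      by do 2 split=> //; apply: (mulfI a0); rewrite yE DE.
    move: (Fe); rewrite FE => /andP[h1 h2]; split=> //; split; first exact/eqP.
    by exists (D (e 0%N / a)); rewrite yE DE//; split=> //; split; rewrite ?nE.
  repeat definability; apply: (definable_rel2 IH); repeat definability.
have near0E N x y : - a < x -> `|x| <= a ^+ N -> near0 N x y <-> y = D x.
  by move=> ax xN; split=> [[_ []]//|->]; do 2 split=> //; exact: F_neq0.
(* Chosen so that [(c, 1]] lies in the range of [near0 N]. *)
have [N cN] : exists N, `|c| <= a ^+ N.
  have /cvgr0Pnorm_lt/(_ _ ltr01)[N _ hN] := cvg_scaleV a_gt1 c.
  exists N; have := hN N (leqnn _); rewrite normrM normfV normrX (gtr0_norm a_gt0).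
  by rewrite ltr_pdivrMl ?exprn_gt0// mulr1 => /ltW.
(* The equation [Theta x = Theta (x / t)] is solved for [D x], with [t] in [a^Z] bringing [x] into
   [[1, a]]; all other arguments of [D] then lie in [(0, a]], the range of [near0 1]. *)
pose far x y := exists t, (exists k : int, t = a ^ k) /\ 1 <= x / t /\ x / t <= a /\
  exists y1, near0 1 (x / t) y1 /\ exists y2, near0 1 (x / t)^-1 y2 /\
  exists y3, near0 1 x^-1 y3 /\
  x * y + x^-1 * y3 + x / (1 + x) ^+ 2 =
    x / t * y1 + (x / t)^-1 * y2 + x / t / (1 + x / t) ^+ 2.
have dfar : definable L (fun e => far (e 0%N) (e 1%N)).
  rewrite /far; repeat definability;
    try by apply: (definable_rel2 (dnear 1%N)); repeat definability.
  exact: dA.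
have near1E x y : 0 < x -> x <= a -> near0 1 x y <-> y = D x.
  move=> x0 xa; apply: near0E; first by rewrite (lt_trans _ x0)// oppr_lt0.
  by rewrite expr1 gtr0_norm.
have inva x : 1 <= x -> x^-1 <= a.
  by move=> x1; rewrite (le_trans _ (ltW a_gt1))// invf_le1// (lt_le_trans ltr01).
have farE x y : 1 < x -> far x y <-> y = D x.
  move=> x1; have x0 : 0 < x := lt_trans ltr01 x1.
  have ThE (k' : int) : Theta a x = Theta a (x / a ^ k').
    rewrite -(@Theta_scalez _ _ a_gt1 k' (x / a ^ k')) ?divr_gt0 ?exprz_gt0//.
    by rewrite mulrC divfK// expfz_neq0// lt0r_neq0.
  split=> [[t [[k' tk] [h1 [h2 [y1 [H1 [y2 [H2 [y3 [H3 E0]]]]]]]]]]|->].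
    have z0 : 0 < x / t := lt_le_trans ltr01 h1.
    move: H1 H2 H3 E0 => /near1E -> // /near1E -> //; rewrite ?invr_gt0 ?inva//.
    move=> /near1E -> //; rewrite ?invr_gt0 ?inva ?ltW//.
    rewrite -!/(kern _) -/(Theta a _) tk -ThE /Theta => /addIr/addIr/(mulfI (lt0r_neq0 x0)).
    exact.
  have [k' /andP[k1 k2]] := exprz_floor a_gt1 x0; have t0 : 0 < a ^ k' by rewrite exprz_gt0.
  exists (a ^ k'); split; first by exists k'.
  have h1 : 1 <= x / a ^ k' by rewrite ler_pdivlMr// mul1r.
  have h2 : x / a ^ k' <= a.
    by rewrite ler_pdivrMr// mulrC ltW// -[X in _ * X]expr1z -expfzDr// lt0r_neq0.
  have z0 : 0 < x / a ^ k' := lt_le_trans ltr01 h1.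
  do 2 split=> //; exists (D (x / a ^ k')); split; first exact/near1E.
  exists (D (x / a ^ k')^-1); split; first by apply/near1E; rewrite ?invr_gt0 ?inva.
  exists (D x^-1); split; first by apply/near1E; rewrite ?invr_gt0 ?inva ?ltW.
  exact: (ThE k').
apply: (@definable_ext _ _ (fun e => c < e 0%N /\ ((e 0%N <= 1 /\ near0 N (e 0%N) (e 1%N)) \/
    (1 < e 0%N /\ far (e 0%N) (e 1%N))))).
  move=> e; split=> [[ce [[e1 [_ [Fe yE]]]|[e1 /(farE _ _ e1) yE]]]|[[ce Fe] yE]].
  - by [].
  - by split=> //; split=> //; apply: F_gt_neq0 => //; exact: lt_trans e1.
  - split=> //; have [e1|e1] := leP (e 0%N) 1; [left|right]; split=> //; last exact/farE.
    split=> //; rewrite ler_norml (le_trans e1) ?exprn_ege1 ?(ltW a_gt1)// andbT.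
    rewrite (le_trans _ (ltW ce))// lerNl (le_trans _ cN)//.
    by rewrite -normrN ler_norm.
repeat definability; [exact: dnear|exact: dfar].
Qed.

End RestrictedAnalytic.

(** * Rational powers of the base, and the four statements *)

(** With [q = m / n], the elements of the new lattice are the positive [n]-th roots of the [m]-th
    powers of elements of [s^Z]. *)
Lemma powR_rat_lattice (R : realType) (s : R) (q : rat) : 1 < s -> 0 < q ->
  exists m n : nat, (0 < n)%N /\ forall t, (exists k : int, t = (s `^ ratr q) ^ k) <->
    0 < t /\ exists u, (exists k : int, u = s ^ k) /\ t ^+ n = u ^+ m.
Proof.
move=> s1 q0; have s0 : 0 < s := lt_trans ltr01 s1.
have n0 : 0 < numq q by rewrite numq_gt0.
pose m := absz (numq q); pose n := absz (denq q).
have nn : (0 < n)%N by rewrite absz_gt0 denq_neq0.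
set a := s `^ ratr q; have a0 : 0 < a by rewrite powR_gt0.
have an : a ^+ n = s ^+ m.
  rewrite -!powR_mulrn ?powR_ge0 ?(ltW s0)// -powRrM; congr (_ `^ _).
  have -> : n%:R = (denq q)%:~R :> R by rewrite pmulrn gez0_abs.
  have -> : m%:R = (numq q)%:~R :> R by rewrite pmulrn gez0_abs// ltW.
  rewrite -{1}[q]divq_num_den fmorph_div/= !ratr_int divfK//.
  by rewrite intr_eq0 denq_neq0.
have ak (k : int) : (a ^ k) ^+ n = (s ^ k) ^+ m.
  by rewrite !exprnP !exprz_exp ![k * _]mulrC -!exprz_exp -!exprnP an.
exists m, n; split=> // t; split=> [[k ->]|[t0 [_ [[k ->] tn]]]].
  by split; [exact: exprz_gt0|exists (s ^ k); split; [exists k|]].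
exists k; apply/eqP; rewrite -(@eqrXn2 _ n) ?(ltW t0) ?exprz_ge0 ?(ltW a0)//.
by rewrite tn ak.
Qed.

Theorem theorem1p5 (R : realType) (s c : R) (s_gt1 : 1 < s) :
  [/\ defines [set prim (line_graph_on (off_zeros s c) (logder_F s))]
        (@int_set R),
      defines [set prim (line_graph_on (off_zeros s c) (xlogder_F' s))]
        (int_powers s),
      forall r : R, 0 < r -> irrational r ->
        defines
          [set prim (line_graph_on (off_zeros s c) (xlogder_F' s));
               prim (line_graph_on (off_zeros (s `^ r) c) (xlogder_F' (s `^ r)))]
          (@int_set R) &
      forall q : rat, 0 < q ->
        defines (@R_an R `|` [set prim (int_powers s)])
          (line_graph_on (off_zeros (s `^ (ratr q)) c)
             (xlogder_F' (s `^ (ratr q))))].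
Proof.
have pow_gt1 r : 0 < r -> 1 < s `^ r.
  move=> r0; rewrite /powR gt_eqF ?(lt_trans ltr01)//.
  by rewrite expR_gt1 mulr_gt0// ln_gt0.
split.
- apply: defines_line; apply: definable_ext (definable_int_logder s_gt1 (c := c) _).
    by move=> e; split=> -[k]; [exists k|exists k].
  by [].
- apply: defines_line; apply: definable_ext (definable_lattice_xlogder s_gt1 (c := c) _).
    by move=> e; split=> -[k]; [exists k|exists k].
  by [].
- move=> r r0 irr; apply: defines_line.
  apply: definable_ext (definable_int_of_lattices (pow_gt1 r r0) s_gt1 _
    (definable_lattice_xlogder (pow_gt1 r r0) (c := c) _)
    (definable_lattice_xlogder s_gt1 (c := c) _)).
  + by move=> e; split=> -[k]; [exists k|exists k].
  (* The lattices are those of [s] to the power [r] and of [s], so the ratio of logarithms is [r]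
     itself. *)
  + by rewrite ln_powR mulfK// lt0r_neq0// ln_gt0.
  + by right.
  + by left.
- move=> q q0; apply: defines_line_graph.
  have a1 : 1 < s `^ ratr q by apply: pow_gt1; rewrite ltr0q.
  apply: (definable_xlogder a1 c); first by move=> P; left.
  have [m [n [_ H]]] := powR_rat_lattice s_gt1 q0.
  apply: definable_ext (fun e => iff_sym (H (e 0%N))) _.
  repeat definability; apply: (@definable_ext _ _ (fun e => [set s ^ k | k in [set: int]] (e 0%N))).
    by move=> e; split=> [[k _ <-]|[k ->]]; exists k.
  by apply: definable_line; right.
Qed.
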